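(* Let $\mathbb{F}$ be a field with $\operatorname{char}(\mathbb{F})=0$, let $\mathcal{A}$ be a noncommutative prime PI algebra over $\mathbb{F}$, let $f\in\mathbb{F}\langle\bar X\rangle$, and let $\mathcal{L}:=\operatorname{span} f(\mathcal{A})$. Then exactly one of the following four possibilities holds: (i) $f$ is an identity of $\mathcal{A}$; in this case $\widetilde{\mathcal{L}}=0$; (ii) $f$ is a central polynomial of $\mathcal{A}$; in this case $\widetilde{\mathcal{L}}=\widetilde{\mathcal{Z}}$; (iii) $f$ is not an identity of $\mathcal{A}$, but is cyclically equivalent to an identity of $\mathcal{A}$; in this case $\widetilde{\mathcal{L}}=[\widetilde{\mathcal{A}},\widetilde{\mathcal{A}}]$; (iv) $f$ is not a central polynomial of $\mathcal{A}$ and is not cyclically equivalent to an identity of $\mathcal{A}$; in this case $\widetilde{\mathcal{L}}=\widetilde{\mathcal{A}}$.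
   Context: $\mathbb{F}\langle\bar X\rangle$ is the free associative algebra over $\mathbb{F}$ on noncommuting variables $\bar X=\{X_1,X_2,\ldots\}$. For $f=f(X_1,\ldots,X_n)$, $f(\mathcal{A})=\{f(a_1,\ldots,a_n):a_i\in\mathcal{A}\}$ and $\operatorname{span}$ is the $\mathbb{F}$-linear span. $f$ is an identity of $\mathcal{A}$ if $f(\mathcal{A})=\{0\}$; $f$ is a central polynomial of $\mathcal{A}$ if it is not an identity of $\mathcal{A}$ but all its values on $\mathcal{A}$ lie in the center $\mathcal{Z}$ of $\mathcal{A}$. Polynomials $f,g\in\mathbb{F}\langle\bar X\rangle$ are cyclically equivalent if $f-g$ is a sum of commutators $pq-qp$ with $p,q\in\mathbb{F}\langle\bar X\rangle$. Algebras are associative and not necessarily unital; if $\mathcal{A}$ has no identity element, $f$ is understood to have zero constant term. An algebra is prime if the product of any two of its nonzero ideals is nonzero; it is PI if it satisfies a nonzero polynomial identity. For a prime PI algebra $\mathcal{A}$ the center $\mathcal{Z}$ is nonzero; $\widetilde{\mathcal{Z}}$ denotes its field of fractions, and the central closure $\widetilde{\mathcal{A}}$ is the central localization consisting of elements $z^{-1}a$ ($a\in\mathcal{A}$, $0\neq z\in\mathcal{Z}$), a finite dimensional central simple algebra over $\widetilde{\mathcal{Z}}$. For $\mathcal{V}\subseteq\mathcal{A}$, $\widetilde{\mathcal{V}}$ denotes the $\widetilde{\mathcal{Z}}$-linear span of $\mathcal{V}$ in $\widetilde{\mathcal{A}}$. $[\widetilde{\mathcal{A}},\widetilde{\mathcal{A}}]$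 is the linear span of all commutators in $\widetilde{\mathcal{A}}$. *)

(* Defs.v *)
From HB Require Import structures.
From mathcomp Require Import all_boot all_algebra.
From mathcomp Require Import boolp classical_sets.
From mathcomp Require Import finmap.
From mathcomp.multinomials Require Import monalg.

Set Implicit Arguments.
Unset Strict Implicit.
Unset Printing Implicit Defensive.

Import GRing.Theory.
Local Open Scope classical_set_scope.
Local Open Scope ring_scope.

(* Associative, not necessarily unital, algebras over a field: MathComp's ring
   hierarchy is unital, so the product is added on top of lmodType. *)
HB.mixin Record Lmodule_isNUAlgebra (F : fieldType) A of GRing.Lmodule F A := {
  numul : A -> A -> A;
  numulA : associative numul;
  numulDl : left_distributive numul +%R;
  numulDr : right_distributive numul +%R;
  numulZl : forall (c : F) (a b : A), numul (c *: a) b = c *: numul a b;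
  numulZr : forall (c : F) (a b : A), numul a (c *: b) = c *: numul a b
}.

#[short(type="nuAlgType")]
HB.structure Definition NUAlgebra (F : fieldType) :=
  {A of GRing.Lmodule F A & Lmodule_isNUAlgebra F A}.

Notation "a ** b" := (numul a b) (at level 40, left associativity) : ring_scope.

Definition lin_span (F : fieldType) (V : lmodType F) (S : set V) : set V :=
  [set x | exists (n : nat) (c : 'I_n -> F) (v : 'I_n -> V),
     (forall i, S (v i)) /\ x = \sum_i c i *: v i].

Section Algebras.
Variables (F : fieldType) (A : nuAlgType F).

Definition is_identity_elt (e : A) := forall a : A, e ** a = a /\ a ** e = a.

Definition has_identity_elt := exists e : A, is_identity_elt e.

Definition noncommutative := exists a b : A, a ** b <> b ** a.

Definition center : set A := [set z | forall a : A, z ** a = a ** z].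

Definition is_ideal (I : set A) :=
  [/\ I 0,
      forall a b, I a -> I b -> I (a + b),
      forall (c : F) a, I a -> I (c *: a)
    & forall a x, I x -> I (a ** x) /\ I (x ** a)].

Definition ideal_prod (I J : set A) : set A :=
  lin_span [set x | exists a b : A, [/\ I a, J b & x = a ** b]].

Definition prime_algebra :=
  forall I J : set A, is_ideal I -> is_ideal J ->
    I <> [set 0] -> J <> [set 0] -> ideal_prod I J <> [set 0].

End Algebras.

Arguments has_identity_elt {F} A.
Arguments noncommutative {F} A.
Arguments center {F} A.
Arguments prime_algebra {F} A.

(* The free unital associative algebra: the monoid algebra of the free monoid
   of words in the variables X_0, X_1, ... *)
Notation "{ 'free_alg' F }" := {malg F[{fmonom nat}]}
  (at level 0, F at level 2, format "{ 'free_alg'  F }") : type_scope.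

Section Polynomials.
Variables (F : fieldType) (A : nuAlgType F).
Implicit Types f g : {free_alg F}.

(* If A has no identity element, only polynomials with zero constant term can
   be evaluated on A. *)
Definition evaluable f := has_identity_elt A \/ f@_(mone : {fmonom nat}) = 0.

(* The identity element of A if there is one; the junk value 0 otherwise only
   multiplies the constant term, which is then 0 for evaluable polynomials. *)
Definition empty_word_value : A := xget 0 [set e | is_identity_elt e].

(* The clause for one-letter words keeps empty_word_value out of the value of
   every nonempty word. *)
Fixpoint eval_word (a : nat -> A) (w : seq nat) : A :=
  match w with
  | [::] => empty_word_value
  | [:: i] => a i
  | i :: w' => a i ** eval_word a w'
  end.

Definition peval (a : nat -> A) f : A :=
  \sum_(w <- msupp f) f@_w *: eval_word a w.

Definition values f : set A := [set x | exists a : nat -> A, x = peval a f].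

Definition polynomial_identity f := evaluable f /\ values f = [set 0].

Definition central_polynomial f :=
  [/\ evaluable f, ~ polynomial_identity f & values f `<=` center A].

Definition PI := exists g, g <> 0 /\ polynomial_identity g.

Definition cyclically_equivalent f g :=
  exists (n : nat) (p q : 'I_n -> {free_alg F}),
    f - g = \sum_i (p i * q i - q i * p i).

Definition cyc_equiv_to_identity f :=
  exists g, polynomial_identity g /\ cyclically_equivalent f g.

End Polynomials.

Arguments PI {F} A.
Arguments values {F} A f.

Section CentralClosure.
Variables (F : fieldType) (A : nuAlgType F) (B : unitAlgType F).
Variable iota : A -> B.

(* (B, iota) is the localization of A at its nonzero central elements: an
   overalgebra of A in which those become invertible and whose elements are
   exactly the fractions z^-1 a.  This determines it up to isomorphism. *)
Definition is_central_closure :=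
  [/\ [/\ injective iota,
          forall (c : F) a b, iota (c *: a + b) = c *: iota a + iota b
        & forall a b, iota (a ** b) = iota a * iota b],
      forall z, center A z -> z <> 0 -> iota z \is a GRing.unit
    & forall b : B, exists z a,
        [/\ center A z, z <> 0 & b = (iota z)^-1 * iota a]].

(* The field of fractions of the center of A, inside the central closure. *)
Definition center_fractions : set B :=
  [set b | exists z w,
     [/\ center A z, z <> 0, center A w & b = (iota z)^-1 * iota w]].

(* The span of iota @` V over center_fractions. *)
Definition tilde (V : set A) : set B :=
  [set x | exists (n : nat) (c : 'I_n -> B) (v : 'I_n -> A),
     (forall i, center_fractions (c i) /\ V (v i)) /\
     x = \sum_i c i * iota (v i)].

End CentralClosure.

(* Spanning over F or over the field of fractions of the center makes no
   difference here, since c (a b - b a) = (c a) b - b (c a) for central c. *)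
Definition commutator_span (F : fieldType) (B : unitAlgType F) : set B :=
  lin_span [set x | exists a b : B, x = a * b - b * a].

Arguments commutator_span {F} B.

Definition exactly_one4 (P1 P2 P3 P4 : Prop) :=
  [\/ [/\ P1, ~ P2, ~ P3 & ~ P4],
      [/\ ~ P1, P2, ~ P3 & ~ P4],
      [/\ ~ P1, ~ P2, P3 & ~ P4]
    | [/\ ~ P1, ~ P2, ~ P3 & P4]].

(* Main.v *)
Require Import Defs.
From HB Require Import structures.
From mathcomp Require Import all_boot all_algebra.
From mathcomp Require Import boolp classical_sets.
From mathcomp Require Import finmap.
From mathcomp.multinomials Require Import monalg.
From mathcomp Require Import zify.

Set Implicit Arguments.
Unset Strict Implicit.
Unset Printing Implicit Defensive.

Import GRing.Theory.
Local Open Scope classical_set_scope.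
Local Open Scope ring_scope.

(** Let B be the central closure of A, let K be its center and let T be the
    K-span of the values of f in B.

    The coefficient of t in f (a + t c) lies in the span of the values of f.
    For c_i = [a_i, b] this coefficient is [f (a), b], so that T is a Lie ideal
    of B ([span_values_lie_ideal]).  The ring B is simple, and by a theorem of
    Herstein T is then contained in K or contains [B, B]
    ([lie_ideal_dichotomy]).  As B is the direct sum of K and [B, B]
    ([fraction_plus_commutator], [fraction_commutator0]), T is one of 0, K,
    [B, B] and B.  The first two occur if f is an identity or central.  If f is
    cyclically equivalent to an identity, then its values are sums of
    commutators.  Conversely, suppose that all values of f lie in [B, B].  For
    c_i = u a_i the coefficient of t is, modulo commutators, the product of u
    and the sum of all rotations of the words of f.  Weighting each word by the
    inverse of its length gives a polynomial h, cyclically equivalent to f, with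
    u h (a) in [B, B] for all u and a, and this forces h (a) = 0
    ([commutator_values_cyc]).

    Three properties of A carry this argument: a nonzero central element is not
    a sum of commutators ([center_comm_span0]), a nonzero ideal contains nonzero
    central elements ([ideal_meets_center]), and A is, up to central
    denominators, the sum of its center and of its commutators
    ([center_plus_comm_span]).  They reflect the fact, due to Posner, that B is
    a finite dimensional central simple algebra, but they are proved inside A,
    by calculations with the elementary operators v |-> sum_k l_k v r_k.
    Elements x_1, ..., x_n of A together with elementary operators T_i such that
    T_i x_j is 0 for i <> j and a fixed d <> 0 for i = j form a dual system; the
    x_i are then independent over the extended centroid.

    - The size of dual systems is bounded ([dual_system_bound]).  An identity of
      A gives a multilinear one of some degree d ([PI_multilinear]), by which
      every multilinear word of length m is a combination of words without
      descending subsequences of more than d letters ([word_bounded_span]);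
      there are at most d^(2 m) of these ([size_bounded_words]).  On the other
      hand a dual system of size n makes the n! words
      x_s(1) y_1 ... x_s(n) y_n of length 2 n independent, hence
      n! <= d^(4 n).
    - A dual system of maximal size behaves like a basis of A over a field.  It
      gives rise to a trace tau, which vanishes on commutators but not on
      nonzero central elements in characteristic 0.  The trace form is
      nondegenerate and so provides a dual basis g_i in A, as in Razmyslov's
      construction of central polynomials; the values of the Casimir operator
      y |-> sum_i g_i y x_i are central.  This operator vanishes on no nonzero
      ideal, e = sum_i x_i g_i is central and nonzero, and y e and
      sum_i g_i y x_i are congruent modulo commutators ([exists_casimir]). *)

(** * Products and prime algebras *)

Section NonUnital.
Variables (F : fieldType) (A : nuAlgType F).
Implicit Types a b c r v x y z : A.

Lemma numul0l a : 0 ** a = 0.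
Proof. by apply: (addrI (0 ** a)); rewrite -numulDl !addr0. Qed.

Lemma numul0r a : a ** 0 = 0.
Proof. by apply: (addrI (a ** 0)); rewrite -numulDr !addr0. Qed.

Lemma numulNl a b : (- a) ** b = - (a ** b).
Proof. by rewrite -scaleN1r numulZl scaleN1r. Qed.

Lemma numulNr a b : a ** (- b) = - (a ** b).
Proof. by rewrite -scaleN1r numulZr scaleN1r. Qed.

Lemma numulBl a b c : (a - b) ** c = a ** c - b ** c.
Proof. by rewrite numulDl numulNl. Qed.

Lemma numulBr a b c : a ** (b - c) = a ** b - a ** c.
Proof. by rewrite numulDr numulNr. Qed.

Lemma numul_suml I (s : seq I) (P : pred I) (G : I -> A) b :
  (\sum_(i <- s | P i) G i) ** b = \sum_(i <- s | P i) G i ** b.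
Proof.
exact: (big_morph (fun a => a ** b) (fun x y => numulDl x y b) (numul0l b)).
Qed.

Lemma numul_sumr I (s : seq I) (P : pred I) (G : I -> A) b :
  b ** (\sum_(i <- s | P i) G i) = \sum_(i <- s | P i) b ** G i.
Proof.
exact: (big_morph (fun a => b ** a) (fun x y => numulDr b x y) (numul0r b)).
Qed.

Lemma prime_ideals (primeA : prime_algebra A) (I J : set A) :
    is_ideal I -> is_ideal J ->
    (forall x y, I x -> J y -> x ** y = 0) ->
  (forall x, I x -> x = 0) \/ (forall y, J y -> y = 0).
Proof.
move=> idI idJ IJ0; apply: contrapT => /not_orP[nI nJ].
have ne0 (K : set A) : ~ (forall x, K x -> x = 0) -> K <> [set 0].
  by move=> nK K0; apply: nK => x; rewrite K0.
apply: (primeA I J idI idJ (ne0 _ nI) (ne0 _ nJ)).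
apply/seteqP; split=> [_ [n [c [v [vIJ ->]]]]|_ ->] /=; last first.
  exists 0%N, (fun=> 0), (fun=> 0); split; first by case.
  by rewrite big_ord0.
rewrite big1 // => i _.
by have [a [b [Ia Jb ->]]] := vIJ i; rewrite IJ0 // scaler0.
Qed.

(** The elementwise form of primeness: a A b = 0 forces a = 0 or b = 0.  The
    ideals to which the definition is applied are annihilators, because the
    ideal generated by an element has an unwieldy description in the absence
    of an identity. *)
Lemma prime_elt (primeA : prime_algebra A) a b :
  (forall r, a ** r ** b = 0) -> a = 0 \/ b = 0.
Proof.
move=> ab0.
pose J : set A := [set y | forall r, a ** r ** y = 0].
have idJ : is_ideal J.
  split=> [r|x y Jx Jy r|c x Jx r|c x Jx].
  - exact: numul0r.
  - by rewrite numulDr Jx Jy addr0.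
  - by rewrite numulZr Jx scaler0.
  - by split=> r; [rewrite numulA -(numulA a) | rewrite numulA Jx numul0l].
pose I : set A := [set x | forall y, J y -> x ** y = 0].
have idI : is_ideal I.
  split=> [y Jy|x y Ix Iy z Jz|c x Ix z Jz|c x Ix].
  - exact: numul0l.
  - by rewrite numulDl Ix // Iy // addr0.
  - by rewrite numulZl Ix // scaler0.
  - split=> y Jy; rewrite -numulA; first by rewrite Ix // numul0r.
    by apply: Ix; case: idJ => _ _ _ /(_ c y Jy)[].
have [I0|J0] := prime_ideals primeA idI idJ (fun x y Ix => Ix y); last first.
  by right; apply: J0.
left.
have a0 r : a ** r = 0 by apply: I0 => y; apply.
pose K : set A := [set x | forall r, x ** r = 0].
have idK : is_ideal K.
  split=> [r|x y Kx Ky r|c x Kx r|c x Kx].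
  - exact: numul0l.
  - by rewrite numulDl Kx Ky addr0.
  - by rewrite numulZl Kx scaler0.
  - by split=> r; rewrite -numulA ?Kx ?numul0r.
have idT : is_ideal [set: A] by [].
have [|T0] := prime_ideals primeA idK idT (fun x y Kx _ => Kx y).
  exact.
exact: T0.
Qed.

Lemma prime_nzprod (primeA : prime_algebra A) a b :
  a <> 0 -> b <> 0 -> exists r, a ** r ** b <> 0.
Proof.
move=> a0 b0; apply: contrapT => /forallNP H.
by case: (prime_elt primeA (fun r => contrapT (H r))).
Qed.

Lemma prime_lreg (primeA : prime_algebra A) a :
  (forall r, a ** r = 0) -> a = 0.
Proof.
move=> a0; have ara r : a ** r ** a = 0 by rewrite a0 numul0l.
by case: (prime_elt primeA ara).
Qed.

End NonUnital.

(** * Elementary operators *)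

Section ElementaryOperators.
Variables (F : fieldType) (A : nuAlgType F).
Implicit Types (a b c v w r y : A) (s : seq (A * A)) (S T : A -> A).

Definition elop s v : A := \sum_(p <- s) p.1 ** v ** p.2.

Definition is_elop T := exists s, T =1 elop s.

Lemma elop_nil v : elop [::] v = 0. Proof. exact: big_nil. Qed.

Lemma elop_cons p s v : elop (p :: s) v = p.1 ** v ** p.2 + elop s v.
Proof. exact: big_cons. Qed.

Lemma elop_cat s1 s2 v : elop (s1 ++ s2) v = elop s1 v + elop s2 v.
Proof. exact: big_cat. Qed.

Lemma eq_is_elop S T : S =1 T -> is_elop S -> is_elop T.
Proof. by move=> ST [s E]; exists s => v; rewrite -ST. Qed.

Lemma is_elop0 : is_elop (fun=> 0).
Proof. by exists [::] => v; rewrite elop_nil. Qed.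

Lemma is_elop_mul a b : is_elop (fun v => a ** v ** b).
Proof. by exists [:: (a, b)] => v; rewrite elop_cons elop_nil addr0. Qed.

Lemma is_elopD S T : is_elop S -> is_elop T -> is_elop (fun v => S v + T v).
Proof.
by move=> [s1 E1] [s2 E2]; exists (s1 ++ s2) => v; rewrite elop_cat E1 E2.
Qed.

Lemma is_elop_sum I (r : seq I) (P : pred I) (T : I -> A -> A) :
  (forall i, is_elop (T i)) -> is_elop (fun v => \sum_(i <- r | P i) T i v).
Proof.
move=> elT; elim: r => [|i r IHr].
  by apply: (eq_is_elop _ is_elop0) => v; rewrite big_nil.
have [Pi|nPi] := boolP (P i).
  by apply: (eq_is_elop _ (is_elopD (elT i) IHr)) => v; rewrite big_cons Pi.
by apply: (eq_is_elop _ IHr) => v; rewrite big_cons (negPf nPi).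
Qed.

Lemma elop_mull a s v : a ** elop s v = elop [seq (a ** p.1, p.2) | p <- s] v.
Proof.
by rewrite numul_sumr /elop big_map; apply: eq_bigr => p; rewrite !numulA.
Qed.

Lemma elop_mulr a s v : elop s v ** a = elop [seq (p.1, p.2 ** a) | p <- s] v.
Proof.
by rewrite numul_suml /elop big_map; apply: eq_bigr => p; rewrite !numulA.
Qed.

Lemma is_elop_mull a T : is_elop T -> is_elop (fun v => a ** T v).
Proof. by case=> s E; eexists => v; rewrite E elop_mull. Qed.

Lemma is_elop_mulr a T : is_elop T -> is_elop (fun v => T v ** a).
Proof. by case=> s E; eexists => v; rewrite E elop_mulr. Qed.

Lemma is_elopN T : is_elop T -> is_elop (fun v => - T v).
Proof.
case=> s E; exists [seq (- p.1, p.2) | p <- s] => v.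
by rewrite E /elop big_map -sumrN; apply: eq_bigr => p _; rewrite /= !numulNl.
Qed.

Lemma is_elopB S T : is_elop S -> is_elop T -> is_elop (fun v => S v - T v).
Proof. by move=> elS elT; apply/is_elopD/is_elopN. Qed.

Lemma is_elop_comp S T : is_elop S -> is_elop T -> is_elop (fun v => S (T v)).
Proof.
move=> [s E] elT; apply: (eq_is_elop (fun v => esym (E (T v)))).
by apply: is_elop_sum => p; apply/is_elop_mulr/is_elop_mull.
Qed.

Lemma is_elop_prel a T : is_elop T -> is_elop (fun v => T (a ** v)).
Proof.
case=> s E; exists [seq (p.1 ** a, p.2) | p <- s] => v.
by rewrite E /elop big_map; apply: eq_bigr => p _; rewrite !numulA.
Qed.

Lemma is_elop_prer a T : is_elop T -> is_elop (fun v => T (v ** a)).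
Proof.
case=> s E; exists [seq (p.1, a ** p.2) | p <- s] => v.
by rewrite E /elop big_map; apply: eq_bigr => p _; rewrite !numulA.
Qed.

Lemma is_elop_add T v w : is_elop T -> T (v + w) = T v + T w.
Proof.
case=> s E; rewrite !E /elop -big_split; apply: eq_bigr => p _.
by rewrite numulDr numulDl.
Qed.

Lemma is_elop_zero T : is_elop T -> T 0 = 0.
Proof. by move=> elT; apply: (addrI (T 0)); rewrite -is_elop_add // !addr0. Qed.

Lemma is_elop_sub T v w : is_elop T -> T (v - w) = T v - T w.
Proof.
move=> elT; apply/eqP; rewrite eq_sym subr_eq -is_elop_add //.
by rewrite addrNK.
Qed.

Lemma is_elop_bigsum T I (r : seq I) (P : pred I) (G : I -> A) : is_elop T ->
  T (\sum_(i <- r | P i) G i) = \sum_(i <- r | P i) T (G i).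
Proof.
move=> elT; apply: (big_morph T) => [v w|]; first exact: is_elop_add.
exact: is_elop_zero.
Qed.

Lemma is_elop_scale T k v : is_elop T -> T (k *: v) = k *: T v.
Proof.
case=> s E; rewrite !E /elop scaler_sumr; apply: eq_bigr => p _.
by rewrite numulZr numulZl.
Qed.

Lemma is_elop_center T z v : is_elop T -> center A z -> T (z ** v) = z ** T v.
Proof.
case=> s E cz; rewrite !E /elop numul_sumr; apply: eq_bigr => p _.
by rewrite !numulA cz.
Qed.

(** An elementary operator is determined by its restriction to any nonzero
    ideal.  Writing T for sum_k l_k v r_k, the operator
    v |-> T v t r - T (v r t), with r the first r_k, loses one term, so that
    by induction T v t r = T (v r t); the right-hand side vanishes as soon as
    t lies in the ideal. *)
Lemma elop_ideal0 (primeA : prime_algebra A) (I : set A) y0 s :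
    is_ideal I -> I y0 -> y0 <> 0 -> (forall y, I y -> elop s y = 0) ->
  forall v, elop s v = 0.
Proof.
move=> [_ _ _ II] Iy0 y0N0; elim: {s}(size s) {-2}s (erefl (size s)).
  by case=> // _ _ v; rewrite elop_nil.
move=> n IHn [//|[l r] s] /= [sz] TI.
have [r0|/eqP rN0] := eqVneq r 0.
  have Es v : elop ((l, r) :: s) v = elop s v.
    by rewrite elop_cons r0 numul0r add0r.
  by move=> v; rewrite Es; apply: IHn => // y Iy; rewrite -Es; apply: TI.
have key t v :
    elop ((l, r) :: s) v ** t ** r = elop ((l, r) :: s) (v ** r ** t).
  pose s' := [seq (q.1, q.2 ** t ** r - r ** t ** q.2) | q <- s].
  have Es' u : elop s' u = elop ((l, r) :: s) u ** t ** r
                           - elop ((l, r) :: s) (u ** r ** t).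
    rewrite !elop_cons /= !numulDl !numulA opprD addrACA subrr add0r.
    rewrite /elop big_map !numul_suml -sumrB; apply: eq_bigr => q _ /=.
    by rewrite numulBr !numulA.
  apply/eqP; rewrite -subr_eq0 -Es' IHn ?size_map // => y Iy.
  rewrite Es' !TI ?numul0l ?subr0 //.
  by rewrite -numulA; case: (II (r ** t) y Iy).
move=> v; have Tvtr t u : elop ((l, r) :: s) v ** t ** y0 ** u ** r = 0.
  rewrite -!numulA (numulA y0) (numulA t) numulA key TI //.
  have Ity : I (t ** (y0 ** u)).
    by have [] // := II t (y0 ** u); case: (II u y0 Iy0).
  by have [] := II (v ** r) _ Ity.
have Tvt t : elop ((l, r) :: s) v ** t ** y0 = 0.
  by case: (prime_elt primeA (Tvtr t)).
by case: (prime_elt primeA Tvt).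
Qed.

Lemma elop_ideal d : is_ideal [set u | exists s, u = elop s d].
Proof.
split=> [|_ _ [s ->] [t ->]|c _ [s ->]|a _ [s ->]].
- by exists [::]; rewrite elop_nil.
- by exists (s ++ t); rewrite elop_cat.
- exists [seq (c *: p.1, p.2) | p <- s]; rewrite /elop big_map scaler_sumr.
  by apply: eq_bigr => p _; rewrite !numulZl.
- by split; eexists; rewrite (elop_mull, elop_mulr).
Qed.

Lemma elop_ideal_neq0 (primeA : prime_algebra A) d : d <> 0 ->
  exists y, [set u | exists s, u = elop s d] y /\ y <> 0.
Proof.
move=> dN0; have [r rN0] := prime_nzprod primeA dN0 dN0.
have [r' r'N0] := prime_nzprod primeA dN0 rN0.
exists (d ** r' ** (d ** r ** d)); split=> //.
by exists [:: (d ** r', r ** d)]; rewrite elop_cons elop_nil addr0 /= !numulA.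
Qed.

End ElementaryOperators.

(** The commutators of A itself, as opposed to [commutator_span], which needs an
    identity element. *)
Definition comm_span (F : fieldType) (A : nuAlgType F) : set A :=
  lin_span [set x | exists a b : A, x = a ** b - b ** a].
Arguments comm_span {F} A.

(** * Dual systems *)

(** The x i play the role of a basis of A over its extended centroid, and the
    T i that of the coordinate functionals multiplied by d: the value of the
    i-th coordinate at v is the ratio of T i v and d.  An element proportional
    to d over the extended centroid stands for a scalar, which makes the
    construction of the extended centroid itself unnecessary. *)
Definition dual_system (F : fieldType) (A : nuAlgType F) N
    (x : 'I_N -> A) (T : 'I_N -> A -> A) (d : A) :=
  [/\ d <> 0, forall i, is_elop (T i)
    & forall i j, T i (x j) = if i == j then d else 0].

Definition complete (F : fieldType) (A : nuAlgType F) N (x : 'I_N -> A) :=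
  forall S, is_elop S -> (forall i, S (x i) = 0) -> forall v, S v = 0.

(** * Multilinear identities *)

Section MultilinearIdentities.
Variables (F : fieldType) (A : nuAlgType F).
Implicit Types (a y : nat -> A) (w t : seq nat) (v : A).

(** Words act on A from the left.  Compared with their values, this avoids a
    special case for the empty word, which has no value in general. *)
Definition word_act a w v : A := foldr (fun k (x : A) => a k ** x) v w.

Lemma word_act_cat a w1 w2 v :
  word_act a (w1 ++ w2) v = word_act a w1 (word_act a w2 v).
Proof. exact: foldr_cat. Qed.

Lemma word_act0 a w : word_act a w 0 = 0.
Proof. by elim: w => //= k w ->; rewrite numul0r. Qed.

Lemma word_act_sum a w I (r : seq I) (P : pred I) (c : I -> F) (h : I -> A) :
  word_act a w (\sum_(i <- r | P i) c i *: h i)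
  = \sum_(i <- r | P i) c i *: word_act a w (h i).
Proof.
elim: w => //= k w ->; rewrite numul_sumr.
by apply: eq_bigr => i _; rewrite numulZr.
Qed.

Lemma word_act_eval a w v : w <> [::] -> eval_word a w ** v = word_act a w v.
Proof.
elim: w => // k [|k' w] IHw _ //.
by rewrite [LHS]/= -numulA IHw.
Qed.

Lemma eq_in_word_act a b w v :
  {in w, a =1 b} -> word_act a w v = word_act b w v.
Proof.
elim: w => //= k w IHw ab; rewrite ab ?mem_head // IHw // => j jw.
by rewrite ab // inE jw orbT.
Qed.

(** L is a formal sum in which a word may occur several times, whence the sum
    that computes the coefficient of the increasing word. *)
Definition multilinear_identity d (L : seq (F * seq nat)) :=
  [/\ (0 < d)%N, {in L, forall p, perm_eq p.2 (iota 0 d)},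
      \sum_(p <- L | p.2 == iota 0 d) p.1 != 0
    & forall y v, \sum_(p <- L) p.1 *: word_act y p.2 v = 0].

(** The words t for which t_1 t_2 ... occurs in the expansion of the word u
    when each letter j is replaced by the sum of the variables y_k over the
    positions k of j in w. *)
Fixpoint lifts w u : seq (seq nat) :=
  if u is j :: u' then
    [seq k :: t | k <- [seq k <- iota 0 (size w) | nth 0%N w k == j],
                  t <- lifts w u']
  else [:: [::]].

Lemma word_act_lifts w y u v :
  word_act (fun j => \sum_(k <- iota 0 (size w) | nth 0%N w k == j) y k) u v
  = \sum_(t <- lifts w u) word_act y t v.
Proof.
elim: u v => [|j u IHu] v /=; first by rewrite big_seq1.
rewrite IHu numul_suml big_allpairs_dep /= big_filter.
by apply: eq_bigr => k _; rewrite numul_sumr.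
Qed.

Lemma size_lifts w u t : t \in lifts w u -> size t = size u.
Proof.
elim: u t => [|j u IHu] t /=; first by rewrite inE => /eqP ->.
by case/allpairsPdep => k [t' [_ /IHu <- ->]].
Qed.

Lemma map_nth_lifts w u t : t \in lifts w u -> map (nth 0%N w) t = u.
Proof.
elim: u t => [|j u IHu] t /=; first by rewrite inE => /eqP ->.
case/allpairsPdep => k [t' [kj /IHu <- ->]] /=.
by move: kj; rewrite mem_filter => /andP[/eqP -> _].
Qed.

Lemma mem_lifts w t : {in t, forall k, (k < size w)%N} ->
  t \in lifts w (map (nth 0%N w) t).
Proof.
elim: t => [|k t IHt] tw //=; apply: allpairs_f.
  by rewrite mem_filter eqxx mem_iota /= add0n tw ?mem_head.
by apply: IHt => j jt; rewrite tw // inE jt orbT.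
Qed.

(** Replacing one variable by 0 separates the words that contain it, so that the
    part of an identity in which given variables all occur is an identity. *)
Lemma identity_part (P : seq (F * seq nat)) :
    (forall y v, \sum_(p <- P) p.1 *: word_act y p.2 v = 0) ->
  forall k y v, \sum_(p <- P | all (mem p.2) (iota 0 k))
                  p.1 *: word_act y p.2 v = 0.
Proof.
move=> P0; elim=> [|k IHk] y v; first by rewrite -[RHS](P0 y v).
rewrite (eq_bigl (fun p => all (mem p.2) (iota 0 k) && (k \in p.2)));
  last first.
  by move=> p; rewrite -(addn1 k) iotaD all_cat /= andbT add0n.
have := IHk y v; rewrite (bigID (fun p : F * seq nat => k \in p.2)) /=.
have -> : \sum_(p <- P | all (mem p.2) (iota 0 k) && (k \notin p.2))
     p.1 *: word_act y p.2 v = 0.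
  pose y0 j := if j == k then 0 else y j.
  rewrite -[RHS](IHk y0 v) [RHS](bigID (fun p : F * seq nat => k \in p.2)) /=.
  rewrite [X in _ = X + _]big1 ?add0r; last first.
    move=> p /andP[_]; elim: p.2 => //= j w IHw; rewrite inE /y0.
    case/orP=> [/eqP<-|kw]; first by rewrite eqxx numul0l scaler0.
    by rewrite -numulZr IHw // numul0r.
  apply: eq_bigr => p /andP[_ kp]; congr (_ *: _).
  apply: eq_in_word_act => j jp; rewrite /y0.
  by case: eqP kp => // <-; rewrite jp.
by rewrite addr0.
Qed.

Hypotheses (charF0 : [pchar F] =i pred0).

(** The full linearization of a longest word of an identity. *)
Lemma PI_multilinear (a0 : A) : a0 <> 0 -> PI A ->
  exists d L, multilinear_identity d L.
Proof.
move=> a0N0 [g [gN0 [evg valg]]].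
have gact a v : \sum_(u <- msupp g) g@_u *: word_act a u v = 0.
  have : peval a g ** v = 0.
    have : values A g (peval a g) by exists a.
    by rewrite valg => ->; rewrite numul0l.
  rewrite /peval numul_suml => {2}<-; apply: eq_big_seq => u ug.
  rewrite numulZl; have [u0|/eqP uN0] := eqVneq (u : seq nat) [::]; last first.
    by rewrite word_act_eval.
  rewrite u0 /=; case: evg => [hasid|g1].
    by rewrite /empty_word_value; case: xgetP => [e _ ide|/(_ _)/= noid];
      [rewrite (ide v).1 | case: hasid => e /noid].
  have -> : u = mone by apply/eqP; rewrite fmP u0 fm1.
  by rewrite g1 !scale0r.
have [w wg wmax] : exists2 w, w \in msupp g
    & {in msupp g, forall u : {fmonom nat}, (size u <= size w)%N}.
  have : msupp g != fset0 by rewrite msupp_eq0; apply/eqP.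
  case/fset0Pn => w0 w0g.
  have [w _ wmax] := @arg_maxnP (msupp g) [` w0g]%fset predT
    (fun u => size (val u)) isT.
  by exists (val w) => [|u ug]; [apply: valP | apply: (wmax [` ug]%fset)].
pose d := size w.
pose P := [seq (g@_u, t) | u <- msupp g, t <- lifts w u].
have P0 y v : \sum_(p <- P) p.1 *: word_act y p.2 v = 0.
  rewrite /P big_allpairs_dep /= -[RHS](gact (fun j =>
    \sum_(k <- iota 0 (size w) | nth 0%N w k == j) y k) v).
  by apply: eq_bigr => u _; rewrite word_act_lifts scaler_sumr.
pose L := [seq p <- P | all (mem p.2) (iota 0 d)].
have Lperm : {in L, forall p, perm_eq p.2 (iota 0 d)}.
  move=> p; rewrite mem_filter => /andP[/allP pd].
  case/allpairsPdep=> u [t [ug tu pE]].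
  move: pd; rewrite pE /= => pd.
  have szt : (size t <= size (iota 0 d))%N.
    by rewrite (size_lifts tu) size_iota wmax.
  have [_ tE] := uniq_min_size (iota_uniq 0 d) pd szt.
  by rewrite uniq_perm ?iota_uniq ?(leq_size_uniq (iota_uniq 0 d) pd szt).
have L0 y v : \sum_(p <- L) p.1 *: word_act y p.2 v = 0.
  by rewrite big_filter identity_part.
have Lc : \sum_(p <- L | p.2 == iota 0 d) p.1 != 0.
  rewrite big_filter_cond.
  have -> : \sum_(p <- P | all (mem p.2) (iota 0 d) && (p.2 == iota 0 d)) p.1
      = \sum_(p <- P | p.2 == iota 0 d) p.1.
    apply: eq_bigl => p; case: eqP => [->|]; rewrite ?andbF ?andbT //.
    exact/allP.
  rewrite big_mkcond /P big_allpairs_dep /=.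
  rewrite (bigD1_seq w) ?fset_uniq //= [X in _ + X]big1 ?addr0; last first.
    move=> u uw; rewrite big1_seq // => t /= tu; case: eqP => // td.
    move: uw; have := map_nth_lifts tu; rewrite td -[map _ _]/(mkseq _ _).
    by rewrite mkseq_nth => wu; rewrite fmP wu eqxx.
  rewrite -big_mkcond big_const_seq iter_addr_0 -mulr_natr.
  rewrite mulf_neq0 ?mcoeff_neq0 //.
  rewrite ((pcharf0P F).1 charF0) -lt0n -has_count; apply/hasP.
  exists (iota 0 d); rewrite ?eqxx //.
  have : iota 0 d \in lifts w (map (nth 0%N w) (iota 0 d)).
    by apply: mem_lifts => k; rewrite mem_iota.
  by rewrite -[map _ _]/(mkseq _ _) mkseq_nth.
(* An identity of degree 0 would say that A = 0. *)
exists d, L; split=> //; rewrite lt0n; apply/eqP => d0.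
have := L0 (fun=> 0) a0.
rewrite (eq_big_seq (fun p => p.1 *: a0)) => [|p /Lperm]; last first.
  by rewrite d0 => /perm_size/size0nil ->.
rewrite -scaler_suml => /eqP; rewrite scaler_eq0 => /orP[|/eqP//].
have -> : \sum_(p <- L) p.1 = \sum_(p <- L | p.2 == iota 0 d) p.1.
  rewrite big_seq_cond [RHS]big_seq_cond; apply: eq_bigl => p.
  case pL: (p \in L) => //=; have := Lperm p pL.
  by rewrite d0 => /perm_size/size0nil ->.
by rewrite (negPf Lc).
Qed.

End MultilinearIdentities.

(** * Words without long descending subsequences *)

(** Pairs each letter k of a word with the length, less one, of the longest
    descending subsequence starting at k. *)
Fixpoint labels (w : seq nat) : seq (nat * nat) :=
  if w is k :: u then
    (k, \max_(p <- labels u | (p.1 < k)%N) p.2.+1) :: labels u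
  else [::].

(** No descending subsequence has more than d letters. *)
Definition descent_bounded d w := all (fun p => (p.2 < d)%N) (labels w).

Definition block (b : nat * seq nat) : seq nat := b.1 :: b.2.

Lemma unzip1_labels w : unzip1 (labels w) = w.
Proof. by elim: w => //= k w ->. Qed.

Lemma size_labels w : size (labels w) = size w.
Proof. by rewrite -[in RHS](unzip1_labels w) size_map. Qed.

Lemma labelsP w p : p \in labels w ->
  exists u u', w = u ++ p.1 :: u'
            /\ p.2 = \max_(q <- labels u' | (q.1 < p.1)%N) q.2.+1.
Proof.
elim: w => // k w IHw; rewrite inE => /orP[/eqP ->|/IHw[u [u' [-> pE]]]].
  by exists [::], w.
by exists (k :: u), u'.
Qed.

(** A descending subsequence cuts a word into blocks that begin with its
    terms. *)
Lemma descending_blocks e k u :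
    (e <= \max_(p <- labels u | (p.1 < k)%N) p.2.+1)%N ->
  exists u0 bs, [/\ u = u0 ++ flatten (map block bs), size bs = e
                 & path gtn k (unzip1 bs)].
Proof.
elim: e k u => [|e IHe] k u; first by exists u, [::]; rewrite cats0.
move=> e_lt.
have /hasP[p pu /andP[pk ep]] :
    has (fun p => (p.1 < k) && (e <= p.2))%N (labels u).
  rewrite -[has _ _]negbK -all_predC; apply: contraL e_lt => /allP H.
  rewrite -leqNgt; apply/bigmax_leqP_seq => p pu pk.
  by have /= := H p pu; rewrite pk /= -ltnNge.
have [u1 [u2 [uE pE]]] := labelsP pu.
rewrite pE in ep; have [u0 [bs [u2E sz pbs]]] := IHe _ _ ep.
exists u1, ((p.1, u0) :: bs); split=> /=; first by rewrite uE u2E.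
  by rewrite sz.
by rewrite pk.
Qed.

Lemma long_descent d w : (0 < d)%N -> ~~ descent_bounded d w ->
  exists u bs, [/\ w = u ++ flatten (map block bs), size bs = d
                & sorted gtn (unzip1 bs)].
Proof.
case: d => // d _ /allPn[p pw]; rewrite -leqNgt => dp.
have [u [u' [wE pE]]] := labelsP pw; rewrite pE in dp.
have [u0 [bs [u'E sz pbs]]] := descending_blocks (ltnW dp).
by exists u, ((p.1, u0) :: bs); rewrite wE u'E /= sz.
Qed.

(** Letters with the same label increase from left to right, so that a word is
    determined by its sequence of labels and the label of each letter. *)
Lemma labels_inj w w' : uniq w -> uniq w' ->
  unzip2 (labels w) = unzip2 (labels w') -> labels w =i labels w' -> w = w'.
Proof.
elim: w w' => [|k u IHu] [|k' u'] //= /andP[ku uu] /andP[ku' uu'].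
set c := \max_(p <- labels u | _) _; set c' := \max_(p <- labels u' | _) _.
case=> cc' Eu E.
have not_lt (j j' b : nat) v' :
    b = \max_(p <- labels v' | (p.1 < j')%N) p.2.+1 ->
    (j, b) \in (j', b) :: labels v' -> ~~ (j < j')%N.
  move=> bE; rewrite inE => /orP[/eqP[->]|jv']; first by rewrite ltnn.
  apply/negP => jj'; suff: (b < b)%N by rewrite ltnn.
  rewrite {2}bE -[b.+1]/((j, b).2.+1).
  by apply: (@leq_bigmax_seq _ _ (fun q => q.1 < j')%N (fun q => q.2.+1)).
have kk' : k = k'.
  have [lt_kk'|lt_k'k|//] := ltngtP k k'.
    suff: ~~ (k < k')%N by rewrite lt_kk'.
    by apply: (not_lt k k' c u' cc'); rewrite {2}cc' -E mem_head.
  suff: ~~ (k' < k)%N by rewrite lt_k'k.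
  by apply: (not_lt k' k c u erefl); rewrite {1}cc' E mem_head.
subst k'; congr (_ :: _); apply: IHu => // p.
have nk v b : k \notin v -> (k, b) \notin labels v.
  by apply: contra => /(map_f fst); rewrite -[map _ _]/(unzip1 _) unzip1_labels.
have := E p; rewrite !inE -cc'; case: eqP => //= -> _.
by rewrite (negPf (nk _ _ ku)) (negPf (nk _ _ ku')).
Qed.

Definition bounded_words d m :=
  [seq w <- permutations (iota 0 m) | descent_bounded d w].

Lemma mem_bounded_words d m w :
  (w \in bounded_words d m) = descent_bounded d w && perm_eq w (iota 0 m).
Proof. by rewrite mem_filter mem_permutations. Qed.

(** A word is encoded by two sequences of labels, one in the order of the
    positions and one in the order of the letters. *)
Lemma size_bounded_words d m : (0 < d)%N ->
  (size (bounded_words d m) <= (d ^ m) * (d ^ m))%N.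
Proof.
case: d => // d _.
pose label w k := nth 0%N (unzip2 (labels w)) (index k w).
pose code w : m.-tuple 'I_d.+1 * m.-tuple 'I_d.+1 :=
  ([tuple inord (nth 0%N (unzip2 (labels w)) i) | i < m],
   [tuple inord (label w i) | i < m]).
have mem_labels w p : uniq w ->
    (p \in labels w) = (p.1 \in w) && (p.2 == label w p.1).
  case: p => j b; elim: w => //= k w IHw /andP[kw uw].
  rewrite !inE /label /= IHw // xpair_eqE [k == j]eq_sym.
  by have [->|] := eqVneq j k; first by rewrite (negPf kw) /= orbF.
have code_inj : {in bounded_words d.+1 m &, injective code}.
  move=> w w'; rewrite !mem_bounded_words => /andP[bw pw] /andP[bw' pw'].
  have [sw sw'] := (perm_size pw, perm_size pw'); rewrite size_iota in sw sw'.
  have [uw uw'] : uniq w /\ uniq w'.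
    by rewrite (perm_uniq pw) (perm_uniq pw') iota_uniq.
  have lt_label v i : descent_bounded d.+1 v ->
      (nth 0%N (unzip2 (labels v)) i < d.+1)%N.
    move=> /allP bv; have [lt_i|le_i] := ltnP i (size (unzip2 (labels v))).
      by have /mapP[p pv ->] := mem_nth 0%N lt_i; apply: bv.
    by rewrite nth_default.
  have inord_inj i j :
      (i < d.+1)%N -> (j < d.+1)%N -> inord i = inord j :> 'I_d.+1 -> i = j.
    by move=> lti ltj /(congr1 val); rewrite /= !inordK.
  move=> E; apply: labels_inj => //.
    apply: (@eq_from_nth _ 0%N); first by rewrite !size_map !size_labels sw sw'.
    move=> i; rewrite size_map size_labels sw => lt_i.
    apply: inord_inj; try exact: lt_label.
    have := congr1 (fun t => tnth t.1 (Ordinal lt_i)) E.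
    by rewrite !tnth_mktuple.
  move=> p; rewrite !mem_labels // (perm_mem pw) (perm_mem pw').
  rewrite mem_iota add0n /=.
  have [lt_p|//] := ltnP p.1 m; congr (_ == _).
  apply: inord_inj; try exact: lt_label.
  have := congr1 (fun t => tnth t.2 (Ordinal lt_p)) E.
  by rewrite !tnth_mktuple.
have ub : uniq (map code (bounded_words d.+1 m)).
  by rewrite map_inj_in_uniq // filter_uniq ?permutations_uniq.
rewrite -(size_map code) -(card_uniqP ub) (leq_trans (max_card _)) //.
by rewrite card_prod card_tuple card_ord.
Qed.

(** Comparing words of equal length by value in a positional numeral system
    is comparing them lexicographically. *)
Fixpoint numeral m (w : seq nat) : nat :=
  if w is k :: u then (k * m ^ size u + numeral m u)%N else 0%N.

Lemma numeral_lt m w : all (fun k => k < m)%N w -> (numeral m w < m ^ size w)%N.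
Proof.
elim: w => //= k w IHw /andP[km /IHw lt_w].
rewrite expnS; apply: (@leq_trans (k.+1 * m ^ size w)); last first.
  by rewrite leq_mul2r km orbT.
by rewrite mulSn addnC ltn_add2r.
Qed.

Lemma numeral_cat m w1 w2 w2' : size w2 = size w2' ->
  (numeral m (w1 ++ w2) < numeral m (w1 ++ w2'))%N
  = (numeral m w2 < numeral m w2')%N.
Proof.
move=> sz; elim: w1 => //= k w IHw.
by rewrite !size_cat sz ltn_add2l.
Qed.

(** Blocks with decreasing first letters form the lexicographically largest of
    their arrangements: where another arrangement first differs, it begins a
    block with a smaller letter. *)
Lemma numeral_blocks m bs cs : sorted gtn (unzip1 bs) -> perm_eq cs bs ->
    cs <> bs -> all (fun k => k < m)%N (flatten (map block bs)) ->
  (numeral m (flatten (map block cs)) < numeral m (flatten (map block bs)))%N.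
Proof.
elim: bs cs => [|b bs IHbs] [|c cs] //=.
- by move=> _ /perm_size.
- by move=> _ /perm_size.
move=> sbs pcs ncs /andP[b1m]; rewrite all_cat => /andP[b2m bsm].
have [cb|cb] := eqVneq c b.
  subst c; rewrite perm_cons in pcs.
  have sz : size (flatten (map block cs)) = size (flatten (map block bs)).
    exact/perm_size/perm_flatten/perm_map.
  rewrite !size_cat sz ltn_add2l numeral_cat //; apply: IHbs => //.
    exact: path_sorted sbs.
  by move=> E; apply: ncs; rewrite E.
have pflat :
    perm_eq (flatten (map block (c :: cs))) (flatten (map block (b :: bs))).
  exact/perm_flatten/perm_map.
have sz :
    size (c.2 ++ flatten (map block cs)) = size (b.2 ++ flatten (map block bs)).
  by case/perm_size: pflat.
have csm : all (fun k => k < m)%N (c.2 ++ flatten (map block cs)).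
  have := perm_all (fun k => k < m)%N pflat; rewrite /= b1m !all_cat b2m bsm.
  by case/andP.
have cbs : c \in bs.
  have : c \in b :: bs by rewrite -(perm_mem pcs) mem_head.
  by rewrite inE (negPf cb).
have c1b1 : (c.1 < b.1)%N.
  have /allP := order_path_min (rev_trans ltn_trans) sbs.
  by apply; apply: map_f.
rewrite sz.
apply: (@leq_trans (c.1.+1 * m ^ size (b.2 ++ flatten (map block bs)))).
  by rewrite mulSn addnC ltn_add2r -sz numeral_lt.
by apply: leq_trans (leq_addr _ _); rewrite leq_mul2r c1b1 orbT.
Qed.

(** * Multilinear identities bound dual systems *)

Section WordDependence.
Variables (F : fieldType) (A : nuAlgType F).
Variables (d : nat) (L : seq (F * seq nat)).
Hypothesis idL : @multilinear_identity F A d L.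
Implicit Types (w : seq nat) (y : nat -> A) (v : A).

Definition bounded_span m (h : (nat -> A) -> A -> A) := exists c : seq nat -> F,
  forall y v, h y v = \sum_(w <- bounded_words d m) c w *: word_act y w v.

Lemma bounded_span_sum m (I : eqType) (r : seq I) (P : pred I) (k : I -> F) h :
    {in r, forall i, P i -> bounded_span m (h i)} ->
  bounded_span m (fun y v => \sum_(i <- r | P i) k i *: h i y v).
Proof.
elim: r => [|i r IHr] hr.
  exists (fun=> 0) => y v; rewrite big_nil big1 // => w _.
  by rewrite scale0r.
have [c cE] := IHr (fun j jr => hr j (@mem_behead _ (i :: r) j jr)).
have [Pi|nPi] := boolP (P i); last first.
  by exists c => y v; rewrite big_cons (negPf nPi) cE.
have [c' c'E] := hr i (mem_head _ _) Pi.
exists (fun w => k i * c' w + c w) => y v; rewrite big_cons Pi cE c'E.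
rewrite scaler_sumr -big_split; apply: eq_bigr => w _ /=.
by rewrite scalerDl scalerA.
Qed.

(** If w has a descending subsequence of length d, then the identity, applied to
    the blocks that this subsequence cuts, rewrites w as a combination of
    lexicographically smaller words. *)
Lemma word_bounded_span m w : perm_eq w (iota 0 m) ->
  bounded_span m (fun y v => word_act y w v).
Proof.
have [d_gt0 permL coefL idL0] := idL.
have [n] := ubnP (numeral m w); elim: n w => // n IHn w /ltnSE le_wn pw.
have [bw|nbw] := boolP (descent_bounded d w).
  exists (fun w' => (w' == w)%:R) => y v.
  rewrite (bigD1_seq w) /=; first last.
  - by rewrite filter_uniq ?permutations_uniq.
  - by rewrite mem_bounded_words bw.
  rewrite eqxx scale1r big1 ?addr0 // => w' /negPf ->.
  by rewrite scale0r.
have [u [bs [wE sz sbs]]] := long_descent d_gt0 nbw.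
set c := \sum_(p <- L | p.2 == iota 0 d) p.1 in coefL.
pose arrange (t : seq nat) := [seq nth (0%N, [::]) bs i | i <- t].
have arrange_iota : arrange (iota 0 d) = bs.
  by rewrite /arrange -sz -[map _ _]/(mkseq _ _) mkseq_nth.
pose rearranged (t : seq nat) := u ++ flatten (map block (arrange t)).
have rearranged_iota : rearranged (iota 0 d) = w.
  by rewrite /rearranged arrange_iota.
have wordE y v : word_act y w v = \sum_(p <- L | p.2 != iota 0 d)
    (- c^-1 * p.1) *: word_act y (rearranged p.2) v.
  (* The blocks are nonempty, so that they have values z i in A. *)
  pose z i := eval_word y (block (nth (0%N, [::]) bs i)).
  have zE t : word_act z t v = word_act y (flatten (map block (arrange t))) v.
    by elim: t => //= i t IHt; rewrite IHt word_act_eval // -word_act_cat.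
  have : \sum_(p <- L) p.1 *: word_act y (rearranged p.2) v = 0.
    transitivity (word_act y u (\sum_(p <- L) p.1 *: word_act z p.2 v)).
      rewrite word_act_sum; apply: eq_bigr => p _.
      by rewrite zE -word_act_cat.
    by rewrite idL0 word_act0.
  rewrite (bigID (fun p : F * seq nat => p.2 == iota 0 d)) /=.
  under eq_bigr => p /eqP pE do rewrite pE rearranged_iota.
  rewrite -scaler_suml -/c => /eqP; rewrite addr_eq0 => /eqP cE.
  rewrite -[LHS](scalerK coefL) cE scalerN scaler_sumr -sumrN.
  by apply: eq_bigr => p _; rewrite scalerA mulNr scaleNr.
have [k kE] : bounded_span m (fun y v => \sum_(p <- L | p.2 != iota 0 d)
    (- c^-1 * p.1) *: word_act y (rearranged p.2) v).
  apply: bounded_span_sum => p pL pd.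
  have parr : perm_eq (arrange p.2) bs.
    by rewrite -[X in perm_eq _ X]arrange_iota; apply/perm_map/permL.
  have prear : perm_eq (rearranged p.2) w.
    by rewrite wE perm_cat2l; apply/perm_flatten/perm_map.
  apply: IHn; last exact: perm_trans pw.
  apply: leq_trans le_wn; rewrite wE numeral_cat; last first.
    exact/perm_size/perm_flatten/perm_map.
  apply: numeral_blocks => //.
    move=> arrE; move/eqP: pd; apply.
    have ubs : uniq bs.
      have : uniq (unzip1 bs).
        apply: sorted_uniq sbs; first exact: (rev_trans ltn_trans).
        by move=> i; rewrite /= ltnn.
      exact: map_uniq.
    apply: (@inj_in_map _ _ (nth (0%N, [::]) bs) [pred i | (i < d)%N]).
    - by move=> i j; rewrite !inE -sz => lti ltj /eqP;
        rewrite nth_uniq // => /eqP.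
    - by apply/allP => i; rewrite (perm_mem (permL _ pL)) mem_iota.
    - by apply/allP => i; rewrite mem_iota.
    by rewrite -/(arrange p.2) arrE -/(arrange _) arrange_iota.
  have : all (fun k => k < m)%N w.
    by apply/allP => i; rewrite (perm_mem pw) mem_iota.
  by rewrite wE all_cat => /andP[].
by exists k => y v; rewrite wordE kE.
Qed.

Lemma words_dependent m (W : seq (seq nat)) : uniq W ->
    {in W, forall w, perm_eq w (iota 0 m)} ->
    (size (bounded_words d m) < size W)%N ->
  exists2 b : seq nat -> F, exists2 w, w \in W & b w != 0
    & forall y v, \sum_(w <- W) b w *: word_act y w v = 0.
Proof.
move=> uW permW ltW; pose B := bounded_words d m.
have spanW (i : 'I_(size W)) :=
  word_bounded_span (permW _ (mem_nth [::] (ltn_ord i))).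
have [c cE] := choice spanW.
pose C := \matrix_(i < size W, j < size B) c i (nth [::] B j).
have : kermx C != 0.
  rewrite kermx_eq0 -row_leq_rank -ltnNge.
  exact: leq_ltn_trans (rank_leq_col C) ltW.
case/rowV0Pn => k /sub_kermxP kC kN0.
have [i ki] : exists i, k 0 i != 0.
  by apply/existsP; apply: contraNT kN0; rewrite negb_exists => /forallP k0;
     apply/eqP/rowP => i; rewrite mxE; apply/eqP; rewrite -[_ == _]negbK k0.
exists (fun w => oapp (k 0) 0 (insub (index w W))).
  exists (nth [::] W i); first exact: mem_nth.
  by rewrite index_uniq // valK.
move=> y v; rewrite (big_nth [::]) big_mkord.
transitivity
  (\sum_(j < size W) \sum_(w <- B) (k 0 j * c j w) *: word_act y w v).
  apply: eq_bigr => j _; rewrite index_uniq // valK /= cE scaler_sumr.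
  by apply: eq_bigr => w _; rewrite scalerA.
rewrite exchange_big (big_nth [::]) big_mkord big1 // => l _ /=.
rewrite -scaler_suml.
have := congr1 (fun M : 'rV_(size B) => M 0 l) kC; rewrite !mxE.
by under eq_bigr => j _ do rewrite mxE; move=> ->; rewrite scale0r.
Qed.

End WordDependence.

(** Odd letters stand for the elements x_k of a dual system, even letters for
    variables: the word of s is x_(s_0) y_l x_(s_1) y_(l+1) ... *)
Fixpoint interleave l (s : seq nat) : seq nat :=
  if s is k :: s' then [:: k.*2.+1, l.*2 & interleave l.+1 s'] else [::].

Lemma mem_interleave l s j : (j \in interleave l s)
  = if odd j then j./2 \in s else (l <= j./2 < l + size s)%N.
Proof.
elim: s l => [|k s IHs] l /=; first by rewrite addn0 ltnNge andbN if_same.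
rewrite !inE IHs.
have -> : (j == k.*2.+1) = odd j && (j./2 == k) by lia.
have -> : (j == l.*2) = ~~ odd j && (j./2 == l) by lia.
by case: (odd j) => //=; lia.
Qed.

Lemma interleave_uniq l s : uniq s -> uniq (interleave l s).
Proof.
elim: s l => //= k s IHs l /andP[ks us]; rewrite inE !mem_interleave IHs //.
rewrite /= !odd_double /= uphalf_double doubleK ltnn (negPf ks) orbF !andbT.
by apply/eqP; lia.
Qed.

Lemma perm_interleave n s : perm_eq s (iota 0 n) ->
  perm_eq (interleave 0 s) (iota 0 (n + n)).
Proof.
move=> ps; have us : uniq s by rewrite (perm_uniq ps) iota_uniq.
have sz := perm_size ps; rewrite size_iota in sz.
apply: uniq_perm; rewrite ?interleave_uniq ?iota_uniq // => j.
rewrite mem_interleave (perm_mem ps) !mem_iota !add0n sz /= if_same.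
by rewrite ltn_half_double addnn.
Qed.

Lemma interleave_inj l : injective (interleave l).
Proof.
by move=> s; elim: s l => [|k s IHs] l [|k' s'] //= [/double_inj -> /IHs ->].
Qed.

Lemma exists_factorial_gt K : exists n, (K ^ n < n`!)%N.
Proof.
have [->|K_gt0] := posnP K; first by exists 1%N.
have fact_ge M m : (M ^ m <= (M + m)`!)%N.
  elim: m => [|m IHm]; first by rewrite fact_gt0.
  by rewrite addnS factS expnS leq_mul // ltnW // ltnS leq_addr.
have fact_gt m : (K ^ (2 * K) < 2 ^ m)%N -> (K ^ (2 * K + m) < (2 * K + m)`!)%N.
  move=> lt_m; apply: leq_trans (fact_ge _ _).
  by rewrite expnD expnMn ltn_pmul2r // expn_gt0 K_gt0.
by eexists; apply: fact_gt; apply: ltn_expl.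
Qed.

Section DualSystemBound.
Variables (F : fieldType) (A : nuAlgType F) (primeA : prime_algebra A).
Implicit Types (w : seq nat) (y : nat -> A) (v : A).

Section Independence.
Variables (n : nat) (x : 'I_n -> A) (T : 'I_n -> A -> A) (e : A).
Hypothesis dualT : dual_system x T e.

Let letter y j := if odd j then oapp x 0 (insub j./2) else y j./2.

(** The words x_k1 y_1 x_k2 y_2 ... are distinguished by their values at a dual
    system x and at arbitrary y: the coordinate operators, applied to the
    successive x_k, separate them. *)
Lemma interleave_indep l (P : seq (F * seq nat)) s :
    {in P, forall p, size p.2 = size s /\ all (fun k => k < n)%N p.2} ->
    all (fun k => k < n)%N s ->
    (forall y v,
       \sum_(p <- P) p.1 *: word_act (letter y) (interleave l p.2) v = 0) ->
  \sum_(p <- P | p.2 == s) p.1 = 0.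
Proof.
have [eN0 elT Tx] := dualT.
elim: s l P => [|k s IHs] l P sP.
  move=> _ P0; apply/eqP; apply: contrapT => /negP cN0; apply: eN0.
  have := P0 (fun=> 0) e; rewrite (eq_big_seq (fun p => p.1 *: e)); last first.
    by move=> p /sP[/size0nil -> _].
  rewrite -scaler_suml => /eqP; rewrite scaler_eq0 => /orP[|/eqP //].
  have -> : \sum_(p <- P) p.1 = \sum_(p <- P | p.2 == [::]) p.1.
    rewrite big_seq_cond [RHS]big_seq_cond; apply: eq_bigl => p.
    by case pP: (p \in P) => //=; have [/size0nil ->] := sP p pP.
  by rewrite (negPf cN0).
move=> /= /andP[lt_k sn] P0; pose i := Ordinal lt_k.
pose P' := [seq (p.1, behead p.2) | p <- P & head 0%N p.2 == k].
have -> : \sum_(p <- P | p.2 == k :: s) p.1 = \sum_(p <- P' | p.2 == s) p.1.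
  rewrite big_map big_filter_cond big_seq_cond [RHS]big_seq_cond.
  apply: eq_bigl => p; case pP: (p \in P) => //=.
  by have [] := sP p pP; case: p.2 => //= k' s' _ _; rewrite eqseq_cons.
apply: (IHs l.+1) => // [p /mapP[q]|y v].
  rewrite mem_filter => /andP[_ qP] -> /=.
  by have [] := sP q qP; case: q.2 => //= k' s' [->] /andP[].
have letter_upd z p : word_act (letter (fun j => if j == l then z else y j))
    (interleave l.+1 p) v = word_act (letter y) (interleave l.+1 p) v.
  apply: eq_in_word_act => j; rewrite mem_interleave /letter.
  by case: odd => // /andP[lj _]; rewrite gtn_eqF.
(* T i is applied to the first letter: its left factors go in front of the
   identity and its right factors are absorbed by the variable y_l. *)
set X := \sum_(p <- _) _.
suff eX r : e ** r ** X = 0 by case: (prime_elt primeA eX).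
have [t tE] := elT i.
transitivity (\sum_(q <- t) q.1 ** (\sum_(p <- P) p.1 *:
   word_act (letter (fun j => if j == l then q.2 ** r else y j))
     (interleave l p.2) v)); last first.
  by rewrite big1 // => q _; rewrite P0 numul0r.
transitivity (\sum_(p <- P) p.1 *:
   (T i (oapp x 0 (insub (head 0%N p.2))) ** r **
    word_act (letter y) (interleave l.+1 (behead p.2)) v)).
  rewrite /X big_map big_filter numul_sumr big_mkcond /= big_seq [RHS]big_seq.
  apply: eq_bigr => p pP; have [_] := sP p pP.
  case: p.2 (sP p pP).1 => //= k' s' _ /andP[lt_k' _].
  rewrite insubT /= Tx -val_eqE /= eq_sym.
  by case: eqP => _; rewrite ?numulZr // !numul0l scaler0.
under [RHS]eq_bigr => q _ do rewrite numul_sumr.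
rewrite exchange_big /= big_seq [RHS]big_seq; apply: eq_bigr => p pP.
rewrite tE /elop !numul_suml scaler_sumr; apply: eq_bigr => q _.
case: p.2 (sP p pP).1 => //= k' s' _; rewrite letter_upd /letter /=.
by rewrite !odd_double /= uphalf_double doubleK eqxx numulZr !numulA.
Qed.

Variables (d : nat) (L : seq (F * seq nat)).
Hypothesis idL : multilinear_identity A d L.

(** The n! independent words of length 2 n lie in a span of dimension at most
    d ^ (4 n). *)
Lemma dual_system_bound : (n`! <= ((d ^ 2) ^ 2) ^ n)%N.
Proof.
have [d_gt0 _ _ _] := idL.
pose W := [seq interleave 0 s | s <- permutations (iota 0 n)].
have uW : uniq W.
  by rewrite map_inj_uniq ?permutations_uniq //; exact: interleave_inj.
have permW : {in W, forall w, perm_eq w (iota 0 (n + n))}.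
  by move=> _ /mapP[s + ->]; rewrite mem_permutations; apply: perm_interleave.
have szW : size W = n`!.
  by rewrite size_map size_permutations ?iota_uniq // size_iota.
apply: leq_trans (_ : size (bounded_words d (n + n)) <= _)%N; last first.
  apply: leq_trans (size_bounded_words _ d_gt0) _.
  rewrite -expnD -!expnM.
  by have -> : (n + n + (n + n) = 2 * (2 * n))%N by lia.
rewrite leqNgt -szW; apply/negP.
move=> /(words_dependent idL uW permW)[b [w wW bw] b0].
have /mapP[s sn wE] := wW.
pose P := [seq (b (interleave 0 s), s) | s <- permutations (iota 0 n)].
have allP s' : s' \in permutations (iota 0 n) ->
    size s' = n /\ all (fun k => k < n)%N s'.
  rewrite mem_permutations => ps'.
  split; first by rewrite (perm_size ps') size_iota.
  by apply/allP => k; rewrite (perm_mem ps') mem_iota.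
have [szs alls] := allP s sn.
have : \sum_(p <- P | p.2 == s) p.1 = 0.
  apply: (interleave_indep (l := 0%N)) => // [p /mapP[s' s'n ->] /=|y v].
    by have [-> ?] := allP s' s'n; rewrite szs.
  by rewrite -[RHS](b0 (letter y) v) /W !big_map.
rewrite big_map /= -big_filter.
have -> : [seq s' <- permutations (iota 0 n) | s' == s] = [:: s].
  by rewrite (filter_pred1_uniq (permutations_uniq _) sn).
by rewrite big_seq1 -wE; apply/eqP.
Qed.

End Independence.
End DualSystemBound.

(** * The trace of a finite dual system *)

Section Trace.
Variables (F : fieldType) (charF0 : [pchar F] =i pred0).
Variables (A : nuAlgType F) (primeA : prime_algebra A).
Variables (N : nat) (x : 'I_N -> A) (T : 'I_N -> A -> A) (d : A).
Hypotheses (dualT : dual_system x T d) (completex : complete x).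
Implicit Types a b c v w r y z : A.

Let dN0 : d <> 0. Proof. by case: dualT. Qed.
Let elT i : is_elop (T i). Proof. by case: dualT. Qed.
Let Tx i j : T i (x j) = if i == j then d else 0. Proof. by case: dualT. Qed.
Local Hint Resolve elT : core.

Lemma lreg_dual a : (forall r, d ** r ** a = 0) -> a = 0.
Proof. by move=> H; case: (prime_elt primeA H). Qed.

(** An identity between elementary operators need only be checked on the x i;
    this is how all identities below are obtained. *)
Lemma coord_expansion S w v : is_elop S ->
  d ** w ** S v = \sum_i T i v ** w ** S (x i).
Proof.
move=> elS; apply/eqP; rewrite -subr_eq0; apply/eqP.
apply: (completex (S := fun v => d ** w ** S v
                       - \sum_i T i v ** w ** S (x i))) => {v}.
  apply: is_elopB; first exact: is_elop_mull.
  by apply: is_elop_sum => i; do 2!apply: is_elop_mulr.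
move=> j; rewrite (bigD1 j) //= Tx eqxx big1 ?addr0 ?subrr // => i ij.
by rewrite Tx (negPf ij) !numul0l.
Qed.

Lemma coord_expansion1 w v : d ** w ** v = \sum_i T i v ** w ** x i.
Proof.
(* The factor s turns both sides into elementary operators in v. *)
apply/eqP; rewrite -subr_eq0; apply/eqP/(prime_lreg primeA) => s.
rewrite numulBl; apply/eqP; rewrite subr_eq0; apply/eqP.
rewrite numul_suml; apply/eqP; rewrite -subr_eq0; apply/eqP.
apply: (completex (S := fun v => d ** w ** v ** s
                       - \sum_i T i v ** w ** x i ** s)) => {v}.
  apply: is_elopB; first exact: is_elop_mul.
  by apply: is_elop_sum => i; do 3!apply: is_elop_mulr.
move=> j; rewrite (bigD1 j) //= Tx eqxx big1 ?addr0 ?subrr // => i ij.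
by rewrite Tx (negPf ij) !numul0l.
Qed.

Lemma coord_comm_d i u w : T i u ** w ** d = d ** w ** T i u.
Proof.
apply/eqP; rewrite -subr_eq0; apply/eqP.
apply: (completex (S := fun u => T i u ** w ** d - d ** w ** T i u)) => [|j].
  apply: is_elopB; last exact: is_elop_mull.
  by do 2!apply: is_elop_mulr.
by rewrite Tx; case: eqP => _; rewrite ?subrr // !numul0l numul0r subrr.
Qed.

Lemma coord_comm i j u v w : T i u ** w ** T j v = T j v ** w ** T i u.
Proof.
apply/eqP; rewrite -subr_eq0; apply/eqP.
apply: (completex (S := fun v => T i u ** w ** T j v - T j v ** w ** T i u))
  => [|k].
  apply: is_elopB; first exact: is_elop_mull.
  by do 2!apply: is_elop_mulr.
rewrite Tx; case: eqP => _; first by rewrite coord_comm_d subrr.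
by rewrite !numul0l numul0r subrr.
Qed.

(** The trace of left multiplication by a, multiplied by d. *)
Definition tau a : A := \sum_i T i (a ** x i).

Lemma is_elop_tau : is_elop tau.
Proof. by apply: is_elop_sum => i; apply: is_elop_prer. Qed.
Local Hint Resolve is_elop_tau : core.

Lemma coord_comm_tau i u a w : T i u ** w ** tau a = tau a ** w ** T i u.
Proof.
by rewrite numul_sumr !numul_suml; apply: eq_bigr => j _; rewrite coord_comm.
Qed.

Lemma tau_comm a b : tau (a ** b) = tau (b ** a).
Proof.
have key u v w : d ** w ** tau (u ** v)
    = \sum_i \sum_k T k (v ** x i) ** w ** T i (u ** x k).
  rewrite numul_sumr; apply: eq_bigr => i _; rewrite -(numulA u v).
  exact: (coord_expansion _ _ (is_elop_prel u (elT i))).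
apply/eqP; rewrite -subr_eq0; apply/eqP/lreg_dual => w.
rewrite numulBr !key exchange_big /=; apply/eqP; rewrite subr_eq0; apply/eqP.
by apply: eq_bigr => i _; apply: eq_bigr => k _; rewrite coord_comm.
Qed.

Lemma tau_center z : center A z -> tau z = N%:R *: (z ** d).
Proof.
move=> cz; rewrite /tau.
under eq_bigr => i _ do rewrite (is_elop_center _ (elT i) cz) Tx eqxx.
by rewrite sumr_const card_ord scaler_nat.
Qed.

Lemma natrF0 n : (0 < n)%N -> n%:R != 0 :> F.
Proof. by rewrite ((pcharf0P F).1 charF0) lt0n. Qed.

Hypothesis N_gt0 : (0 < N)%N.

Lemma tau_center_neq0 z : center A z -> z <> 0 -> tau z <> 0.
Proof.
move=> cz zN0; rewrite tau_center // => /eqP.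
rewrite scaler_eq0 (negPf (natrF0 N_gt0)) /= => /eqP zd0.
have [r||] // := prime_elt primeA (a := z) (b := d).
by rewrite cz -numulA zd0 numul0r.
Qed.

(** A nonzero central element has nonzero trace, a commutator has trace 0. *)
Lemma center_comm_span z : center A z -> comm_span A z -> z = 0.
Proof.
move=> cz [n [c [v [vcomm zE]]]]; apply: contrapT => zN0.
apply: (tau_center_neq0 cz zN0).
rewrite zE (is_elop_bigsum _ _ _ is_elop_tau) big1 // => i _.
have [a [b ->]] := vcomm i.
by rewrite is_elop_scale // is_elop_sub // tau_comm subrr scaler0.
Qed.

Variables (z0 : A) (cz0 : center A z0) (z0N0 : z0 <> 0).

Lemma tau_ideal (I : set A) y : is_ideal I -> I y -> y <> 0 ->
  exists2 y', I y' & tau y' <> 0.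
Proof.
move=> idI Iy yN0; apply: contrapT => H.
have [s Es] := is_elop_tau.
apply: (tau_center_neq0 cz0 z0N0); rewrite Es.
apply: (elop_ideal0 primeA idI Iy yN0) => y' Iy'; rewrite -Es.
by apply: contrapT => t0; apply: H; exists y'.
Qed.

Lemma exists_tau_dual : exists w1 w2, tau (w1 ** d ** w2) <> 0.
Proof.
have [y [Jy yN0]] := elop_ideal_neq0 primeA dN0.
have [_ [s ->] tauN0] := tau_ideal (elop_ideal d) Jy yN0.
apply: contrapT => H; apply: tauN0.
rewrite (is_elop_bigsum _ _ _ is_elop_tau) big1 // => p _.
by apply: contrapT => t0; apply: H; exists p.1, p.2.
Qed.

Section Casimir.
Variables (w1 w2 : A) (tauN0 : tau (w1 ** d ** w2) <> 0).
Variables (sT : 'I_N -> seq (A * A)) (sTE : forall i v, T i v = elop (sT i) v).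

Let delta := tau (w1 ** d ** w2).

(** Up to scalars, the basis dual to x with respect to the trace form. *)
Definition dual_elt i : A := \sum_(q <- sT i) q.2 ** w2 ** w1 ** q.1.

Let g := dual_elt.

Lemma tau_dual_elt i v : tau (g i ** v) = tau (w1 ** T i v ** w2).
Proof.
rewrite sTE /g /dual_elt numul_suml (is_elop_bigsum _ _ _ is_elop_tau).
rewrite numul_sumr numul_suml (is_elop_bigsum _ _ _ is_elop_tau).
apply: eq_bigr => q _.
by rewrite -!numulA tau_comm -!numulA tau_comm -!numulA.
Qed.

Lemma coord_trace_form i v r : T i v ** r ** delta = d ** r ** tau (g i ** v).
Proof.
rewrite tau_dual_elt; apply/eqP; rewrite -subr_eq0; apply/eqP.
apply: (completex (S := fun v => T i v ** r ** delta
                                 - d ** r ** tau (w1 ** T i v ** w2))) => [|j].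
  apply: is_elopB; first by do 2!apply: is_elop_mulr.
  apply: is_elop_mull; apply: (is_elop_comp is_elop_tau).
  by apply/is_elop_mulr/is_elop_mull.
rewrite Tx; case: eqP => _; first by rewrite subrr.
by rewrite numul0r !numul0l (is_elop_zero is_elop_tau) numul0r subrr.
Qed.

(** By [coord_trace_form], an element of the radical has zero coordinates. *)
Lemma trace_form_nondeg p : (forall v, tau (p ** v) = 0) -> p = 0.
Proof.
move=> p0.
have Tp i : T i p = 0.
  have Tpr r : T i p ** r ** delta = 0.
    by rewrite coord_trace_form tau_comm p0 numul0r.
  by case: (prime_elt primeA Tpr).
apply: lreg_dual => w; rewrite coord_expansion1 big1 // => i _.
by rewrite Tp !numul0l.
Qed.

Lemma trace_form_expansion r w v :
  d ** r ** (\sum_i tau (g i ** v) ** w ** x i) = delta ** r ** d ** w ** v.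
Proof.
have -> : delta ** r ** d ** w ** v = delta ** r ** (d ** w ** v).
  by rewrite !numulA.
rewrite (coord_expansion1 w v) !numul_sumr.
apply: eq_bigr => i _; rewrite !numulA -coord_trace_form.
by rewrite coord_comm_tau.
Qed.

(** Since the trace form is nondegenerate, an element sum_k p_k (x) q_k of the
    tensor square of A over its extended centroid is zero if all functionals
    p |-> tau (p v) on the first factor annihilate it, and then the operator
    y |-> sum_k p_k y q_k vanishes. *)
Lemma elop_trace0 s :
    (forall v w, \sum_(k <- s) tau (k.1 ** v) ** w ** k.2 = 0) ->
  forall y, elop s y = 0.
Proof.
move=> s0.
have tau_coord v w j : \sum_(k <- s) tau (k.1 ** v) ** w ** T j k.2 = 0.
  under eq_bigr => k _ do rewrite sTE /elop numul_sumr.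
  rewrite exchange_big big1 //= => q _.
  under eq_bigr => k _ do rewrite !numulA -(numulA _ w q.1).
  by rewrite -numul_suml s0 numul0l.
have move_coord p q v w j r :
    tau (p ** w ** T j q ** v) ** r ** d
    = tau (p ** (w ** d ** v)) ** r ** T j q.
  apply/eqP; rewrite -subr_eq0; apply/eqP.
  apply: (completex (S := fun q => tau (p ** w ** T j q ** v) ** r ** d
      - tau (p ** (w ** d ** v)) ** r ** T j q)) => [|k].
    apply: is_elopB; last exact: is_elop_mull.
    do 2!apply: is_elop_mulr; apply: (is_elop_comp is_elop_tau).
    by apply/is_elop_mulr/is_elop_mull.
  rewrite Tx; case: eqP => _; first by rewrite !numulA subrr.
  by rewrite !numul0r numul0l (is_elop_zero is_elop_tau) !numul0l subrr.
have coord0 w j : \sum_(k <- s) k.1 ** w ** T j k.2 = 0.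
  apply: trace_form_nondeg => v; set u := tau _.
  have ud r : u ** r ** d = 0.
    rewrite /u numul_suml (is_elop_bigsum _ _ _ is_elop_tau) !numul_suml.
    by rewrite -[RHS](tau_coord (w ** d ** v) r j); apply: eq_bigr => k _.
  by case: (prime_elt primeA ud).
have d0 w w' : elop s (w ** d ** w') = 0.
  have reassoc p q : p ** (w ** d ** w') ** q = p ** w ** (d ** w' ** q).
    by rewrite !numulA.
  rewrite /elop.
  under eq_bigr => k _ do rewrite reassoc coord_expansion1 numul_sumr.
  rewrite exchange_big big1 //= => j _.
  under eq_bigr => k _ do rewrite !numulA.
  by rewrite -!numul_suml coord0 !numul0l.
have [y [Jy yN0]] := elop_ideal_neq0 primeA dN0.
apply: (elop_ideal0 primeA (elop_ideal d) Jy yN0).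
have elE : is_elop (elop s) by exists s.
by move=> _ [t ->]; rewrite (is_elop_bigsum _ _ _ elE) big1.
Qed.

Definition casimir y := \sum_i g i ** y ** x i.

(** For all v, both sum_i tau (a g_i v) x_i and sum_i tau (g_i v) x_i a are
    multiples of v a by the same scalar.  Hence the operators
    y |-> sum_i a g_i y x_i and y |-> sum_i g_i y x_i a coincide. *)
Lemma casimir_center y : center A (casimir y).
Proof.
move=> a; apply/eqP; rewrite eq_sym -subr_eq0; apply/eqP.
pose s := [seq (a ** g i, x i) | i <- index_enum 'I_N]
       ++ [seq (- g i, x i ** a) | i <- index_enum 'I_N].
have sE v : elop s v = a ** casimir v - casimir v ** a.
  rewrite elop_cat /elop !big_map /= numul_sumr numul_suml -sumrN.
  congr (_ + _); apply: eq_bigr => i _; first by rewrite !numulA.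
  by rewrite !numulNl !numulA.
rewrite -sE; apply: elop_trace0 => v w; apply: lreg_dual => r.
rewrite big_cat !big_map /=.
under eq_bigr => i _ do rewrite tau_comm numulA tau_comm.
under [X in _ + X]eq_bigr => i _ do
  rewrite numulNl -sub0r is_elop_sub // (is_elop_zero is_elop_tau) sub0r
    !numulNl numulA.
rewrite sumrN -numul_suml numulBr numulA !trace_form_expansion.
by rewrite !numulA subrr.
Qed.

(** If the Casimir operator vanishes on a nonzero ideal, then it vanishes
    identically, and so does sum_i tau (g_i v) w x_i, from which v can be
    recovered. *)
Lemma casimir_ideal (I : set A) y : is_ideal I -> I y -> y <> 0 ->
  exists z, [/\ I z, center A z & z <> 0].
Proof.
move=> idI Iy yN0; apply: contrapT => H.
have IC u : I u -> I (casimir u).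
  have [I0 ID _ IM] := idI; move=> Iu.
  apply: (big_ind I) => // i _.
  have [Ig _] := IM (g i) u Iu.
  by have [] := IM (x i) _ Ig.
pose s := [seq (g i, x i) | i <- index_enum 'I_N].
have sE v : elop s v = casimir v by rewrite /elop big_map.
have C0 v : casimir v = 0.
  rewrite -sE; apply: (elop_ideal0 primeA idI Iy yN0) => u Iu; rewrite sE.
  apply: contrapT => CN0; apply: H; exists (casimir u).
  by split=> //; [apply: IC | apply: casimir_center].
have tau0 w v : \sum_i tau (g i ** v) ** w ** x i = 0.
  under eq_bigr => i _ do rewrite /tau 2!numul_suml.
  rewrite exchange_big big1 //= => j _.
  under eq_bigr => i _ do rewrite sTE /elop 2!numul_suml.
  rewrite exchange_big big1 //= => q _.
  have -> : \sum_i q.1 ** (g i ** v ** x j) ** q.2 ** w ** x i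
      = q.1 ** casimir (v ** x j ** q.2 ** w).
    by rewrite /casimir numul_sumr; apply: eq_bigr => i _; rewrite !numulA.
  by rewrite C0 numul0r.
apply: (@tauN0); apply: (prime_lreg primeA) => r.
have rd u : delta ** r ** u ** d = 0.
  have rdv v : delta ** r ** u ** d ** v ** d = 0.
    by have := trace_form_expansion (r ** u) v d; rewrite tau0 numul0r !numulA.
  by case: (prime_elt primeA rdv).
by case: (prime_elt primeA rd).
Qed.

Definition casimir_elt := \sum_i x i ** g i.

(** The trace form of e and v is a scalar multiple of the trace of v, so that e
    itself is a scalar. *)
Lemma tau_casimir_elt r v :
  d ** r ** tau (casimir_elt ** v) = tau v ** r ** delta.
Proof.
have tauE : tau v = \sum_i T i (v ** x i) by [].
rewrite numul_suml (is_elop_bigsum _ _ _ is_elop_tau) numul_sumr tauE.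
rewrite 2!numul_suml; apply: eq_bigr => i _.
by rewrite -(numulA (x i)) tau_comm -(numulA (g i)) -coord_trace_form.
Qed.

Lemma casimir_elt_center : center A casimir_elt.
Proof.
move=> a; apply/eqP; rewrite -subr_eq0; apply/eqP/trace_form_nondeg => v.
rewrite numulBl is_elop_sub //.
rewrite -(numulA a) [X in _ - X]tau_comm -!numulA -is_elop_sub // -numulBr.
apply: lreg_dual => r; rewrite tau_casimir_elt is_elop_sub // tau_comm subrr.
by rewrite !numul0l.
Qed.

Lemma casimir_elt_neq0 : casimir_elt <> 0.
Proof.
move=> e0; have tz0 := tau_center_neq0 cz0 z0N0.
have tauz0 r : tau z0 ** r ** delta = 0.
  by rewrite -tau_casimir_elt e0 numul0l (is_elop_zero is_elop_tau) numul0r.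
by case: (prime_elt primeA tauz0).
Qed.

Lemma mul_casimir_elt y : comm_span A (y ** casimir_elt - casimir y).
Proof.
exists N, (fun=> 1), (fun i => (y ** x i) ** g i - g i ** (y ** x i)); split.
  by move=> i; exists (y ** x i), (g i).
rewrite numul_sumr -sumrB; apply: eq_bigr => i _.
by rewrite scale1r !numulA.
Qed.

End Casimir.

(** The witness e is sum_i x_i g_i, and z is sum_i g_i y x_i. *)
Lemma exists_casimir :
  (forall (I : set A) y, is_ideal I -> I y -> y <> 0 ->
     exists z, [/\ I z, center A z & z <> 0])
  /\ exists e, [/\ center A e, e <> 0
       & forall y, exists2 z, center A z & comm_span A (y ** e - z)].
Proof.
have [w1 [w2 tauN0]] := exists_tau_dual.
have [sT sTE] := choice elT.
split; first exact: (casimir_ideal tauN0 sTE).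
exists (casimir_elt w1 w2 sT); split.
- exact: (casimir_elt_center tauN0 sTE).
- exact: (casimir_elt_neq0 tauN0 sTE).
move=> y; exists (casimir w1 w2 sT y); first exact: (casimir_center tauN0 sTE).
exact: mul_casimir_elt.
Qed.

End Trace.

(** * Prime algebras with a polynomial identity *)

Section PrimePI.
Variables (F : fieldType) (charF0 : [pchar F] =i pred0).
Variables (A : nuAlgType F) (primeA : prime_algebra A) (PIA : PI A).
Variables (a0 : A) (a0N0 : a0 <> 0).

(** The exchange property: the coordinate operators of a dual system can be
    corrected so as to vanish at a new vector. *)
Lemma dual_system_extend N (x : 'I_N -> A) T d S v :
    dual_system x T d -> is_elop S -> (forall i, S (x i) = 0) -> S v <> 0 ->
  exists (x' : 'I_N.+1 -> A) T' d', dual_system x' T' d'.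
Proof.
move=> [dN0 elT Tx] elS Sx Sv.
have [r dSvN0] := prime_nzprod primeA dN0 Sv.
exists (fun i => oapp x v (unlift ord0 i)).
exists (fun i => if unlift ord0 i is Some j
  then fun u => T j u ** r ** S v - T j v ** r ** S u
  else fun u => d ** r ** S u).
exists (d ** r ** S v); split=> // [i|i j].
  case: unliftP => [j|] _; last exact: is_elop_mull.
  apply: is_elopB; last exact: is_elop_mull.
  by do 2!apply: is_elop_mulr.
case: (unliftP ord0 i) => [i'|] ->; case: (unliftP ord0 j) => [j'|] -> /=.
- rewrite (inj_eq lift_inj) Tx Sx numul0r subr0.
  by case: eqP => // _; rewrite !numul0l.
- by rewrite subrr.
- by rewrite Sx numul0r.
- by [].
Qed.

(** A dual system of maximal size is complete, for otherwise it could be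
    extended. *)
Lemma exists_complete_dual_system :
  exists N (x : 'I_N -> A) T d, [/\ dual_system x T d, complete x & (0 < N)%N].
Proof.
have [d [L idL]] := PI_multilinear charF0 a0N0 PIA.
have [n lt_n] := exists_factorial_gt ((d ^ 2) ^ 2)%N.
pose has_dual N := exists (x : 'I_N -> A) T e, dual_system x T e.
have [N [hasN hasSN]] : exists N, has_dual N /\ ~ has_dual N.+1.
  apply: contrapT => /forallNP H.
  have has_all N : has_dual N.
    elim: N => [|N IHN]; last by apply: contrapT => hasSN; apply: (H N).
    by exists (fun=> 0), (fun=> id), a0; split=> // [] [].
  have [x [T [e dualT]]] := has_all n.
  by have := dual_system_bound primeA dualT idL; rewrite leqNgt lt_n.
have [x [T [e dualT]]] := hasN; exists N, x, T, e; split=> //.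
  move=> S elS Sx v; apply: contrapT => Sv; apply: hasSN.
  exact: dual_system_extend dualT elS Sx Sv.
rewrite lt0n; apply/eqP => N0; move: x T dualT hasN hasSN.
rewrite N0 => x T dualT _ hasSN.
have [r aN0] := prime_nzprod primeA a0N0 a0N0.
have [r' a'N0] := prime_nzprod primeA aN0 a0N0.
apply: hasSN; apply: dual_system_extend dualT (is_elop_mul _ _) _ a'N0.
by case.
Qed.

Lemma center_comm_span0 z : center A z -> comm_span A z -> z = 0.
Proof.
have [N [x [T [d [dualT completex N_gt0]]]]] := exists_complete_dual_system.
exact: center_comm_span dualT completex N_gt0 z.
Qed.

Variables (z0 : A) (cz0 : center A z0) (z0N0 : z0 <> 0).

Lemma ideal_meets_center (I : set A) y : is_ideal I -> I y -> y <> 0 ->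
  exists z, [/\ I z, center A z & z <> 0].
Proof.
have [N [x [T [d [dualT completex N_gt0]]]]] := exists_complete_dual_system.
by have [H _] := exists_casimir charF0 primeA dualT completex N_gt0 cz0 z0N0;
  apply: H.
Qed.

Lemma center_plus_comm_span : exists e, [/\ center A e, e <> 0
  & forall y, exists2 z, center A z & comm_span A (y ** e - z)].
Proof.
have [N [x [T [d [dualT completex N_gt0]]]]] := exists_complete_dual_system.
by have [] := exists_casimir charF0 primeA dualT completex N_gt0 cz0 z0N0.
Qed.

End PrimePI.

(** * Spans and values of polynomials *)

Definition ord_cat n n' X (g : 'I_n -> X) (g' : 'I_n' -> X) (i : 'I_(n + n')) :=
  match split i with inl j => g j | inr j => g' j end.

Lemma ord_catl n n' X (g : 'I_n -> X) (g' : 'I_n' -> X) i :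
  ord_cat g g' (lshift n' i) = g i.
Proof. by rewrite /ord_cat (unsplitK (inl i)). Qed.

Lemma ord_catr n n' X (g : 'I_n -> X) (g' : 'I_n' -> X) i :
  ord_cat g g' (rshift n i) = g' i.
Proof. by rewrite /ord_cat (unsplitK (inr i)). Qed.

Section Span.
Variables (F : fieldType) (V : lmodType F).
Implicit Types (S : set V) (u v : V).

Definition subspace S :=
  [/\ S 0, forall u v, S u -> S v -> S (u + v)
    & forall (c : F) u, S u -> S (c *: u)].

Lemma subspace_sum S I (r : seq I) (P : pred I) (c : I -> F) (h : I -> V) :
    subspace S -> (forall i, P i -> S (h i)) ->
  S (\sum_(i <- r | P i) c i *: h i).
Proof.
by move=> [S0 SD SZ] Sh; apply: big_ind => // i Pi; apply/SZ/Sh.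
Qed.

Lemma subspaceB S u v : subspace S -> S u -> S v -> S (u - v).
Proof. by move=> [_ SD SZ] Su Sv; rewrite -scaleN1r; apply/SD/SZ. Qed.

Lemma lin_span_subset (X S : set V) : subspace S ->
  (forall u, X u -> S u) -> forall u, lin_span X u -> S u.
Proof.
move=> subS XS _ [n [c [v [Xv ->]]]].
by apply: subspace_sum => // i _; apply/XS/Xv.
Qed.

Lemma lin_span_gen (X : set V) u : X u -> lin_span X u.
Proof.
move=> Xu; exists 1%N, (fun=> 1), (fun=> u).
by rewrite big_ord1 scale1r.
Qed.

Lemma lin_span_subspace (X : set V) : subspace (lin_span X).
Proof.
split=> [|_ _ [n [c [v [Xv ->]]]] [n' [c' [v' [Xv' ->]]]]
         |a _ [n [c [v [Xv ->]]]]].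
- by exists 0%N, (fun=> 0), (fun=> 0); rewrite big_ord0; split=> // [[]].
- exists (n + n')%N, (ord_cat c c'), (ord_cat v v'); split.
    by move=> i; rewrite /ord_cat; case: split.
  rewrite big_split_ord; congr (_ + _); apply: eq_bigr => i _.
    by rewrite !ord_catl.
  by rewrite !ord_catr.
- exists n, (fun i => a * c i), v; split=> //.
  by rewrite scaler_sumr; apply: eq_bigr => i _; rewrite scalerA.
Qed.

Hypothesis charF0 : [pchar F] =i pred0.

(** The coefficients of a polynomial function lie in every subspace that
    contains its values: the combination p (2 t) - 2 ^ n p (t) has lower degree
    than p. *)
Lemma poly_coef_subspace S n (h : nat -> V) : subspace S ->
    (forall t : F, S (\sum_(k < n) t ^+ k *: h k)) ->
  forall k, (k < n)%N -> S (h k).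
Proof.
move=> subS; have [S0 SD SZ] := subS; elim: n h => // n IHn h Sh.
have pow2 k : (k < n)%N -> (2%:R ^+ k - 2%:R ^+ n : F) != 0.
  move=> lt_kn; have lt2 : (2 ^ k < 2 ^ n)%N by rewrite ltn_exp2l.
  rewrite -opprB oppr_eq0 -!natrX -natrB ?(ltnW lt2) //.
  by rewrite ((pcharf0P F).1 charF0) subn_eq0 -ltnNge.
have Slow : forall j, (j < n)%N -> S (h j).
  move=> j lt_jn; rewrite -[h j](scalerK (pow2 j lt_jn)); apply: (SZ).
  apply: (IHn (fun k => (2%:R ^+ k - 2%:R ^+ n) *: h k)) => // t.
  have := subspaceB subS (Sh (2%:R * t)) (SZ (2%:R ^+ n) _ (Sh t)).
  rewrite !big_ord_recr /= exprMn scalerDr scalerA opprD addrACA subrr addr0.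
  rewrite scaler_sumr -sumrB; congr S; apply: eq_bigr => i _.
  by rewrite exprMn !scalerA -scalerBl -mulrBl mulrC.
move=> k; rewrite ltnS leq_eqVlt => /predU1P[->|]; last exact: Slow.
have := Sh 1; rewrite big_ord_recr /= expr1n scale1r => Sn.
rewrite -[h n](addKr (\sum_(i < n) 1 ^+ i *: h i)) addrC.
by apply: subspaceB => //; apply: subspace_sum => // i _; apply: Slow.
Qed.

End Span.

Section Evaluation.
Variables (F : fieldType) (A : nuAlgType F).
Implicit Types (a c : nat -> A) (f g p q : {free_alg F}) (u v x y z : A).

Lemma eval_word_cons a i w : w <> [::] ->
  eval_word a (i :: w) = a i ** eval_word a w.
Proof. by case: w. Qed.

Lemma eval_word_cat a w1 w2 : w1 <> [::] -> w2 <> [::] ->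
  eval_word a (w1 ++ w2) = eval_word a w1 ** eval_word a w2.
Proof.
elim: w1 => // i [|j w1] IHw _ w2N0; first by rewrite cat1s eval_word_cons.
by rewrite cat_cons eval_word_cons // IHw // numulA.
Qed.

Lemma pevalEw a f (D : {fset {fmonom nat}}) : (msupp f `<=` D)%fset ->
  peval a f = \sum_(w <- D) f@_w *: eval_word a w.
Proof.
move=> fD; rewrite /peval (big_fset_incl _ fD) // => w _ wf.
by rewrite mcoeff_outdom // scale0r.
Qed.

Lemma pevalD a f g : peval a (f + g) = peval a f + peval a g.
Proof.
pose D := (msupp f `|` msupp g)%fset.
rewrite (@pevalEw a (f + g) D) ?msuppD_le // (@pevalEw a f D) ?fsubsetUl //.
rewrite (@pevalEw a g D) ?fsubsetUr // -big_split; apply: eq_bigr => w _.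
by rewrite mcoeffD scalerDl.
Qed.

Lemma peval0 a : peval a 0 = 0 :> A.
Proof. by rewrite /peval msupp0 big_seq_fset0. Qed.

Lemma pevalN a f : peval a (- f) = - peval a f.
Proof. by apply/eqP; rewrite -addr_eq0 -pevalD addNr peval0. Qed.

Lemma pevalB a f g : peval a (f - g) = peval a f - peval a g.
Proof. by rewrite pevalD pevalN. Qed.

Lemma peval_sum a I (r : seq I) (P : pred I) (h : I -> {free_alg F}) :
  peval a (\sum_(i <- r | P i) h i) = \sum_(i <- r | P i) peval a (h i).
Proof. by apply: (big_morph (peval a)); [apply: pevalD | apply: peval0]. Qed.

Lemma pevalU a k (w : {fmonom nat}) : peval a << k *g w >> = k *: eval_word a w.
Proof.
by rewrite (pevalEw _ msuppU_le) big_seq_fset1 mcoeffUU.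
Qed.

Lemma comm_span_subspace : subspace (comm_span A).
Proof. exact: lin_span_subspace. Qed.

Lemma comm_span_comm x y : comm_span A (x ** y - y ** x).
Proof. by apply: lin_span_gen; exists x, y. Qed.

Lemma comm_span_center z x :
  center A z -> comm_span A x -> comm_span A (z ** x).
Proof.
move=> cz [n [k [v [vc ->]]]]; rewrite numul_sumr.
under eq_bigr => i _ do rewrite numulZr.
apply: subspace_sum => [|i _]; first exact: comm_span_subspace.
have [x1 [y1 ->]] := vc i.
rewrite numulBr; have -> : z ** (y1 ** x1) = y1 ** (z ** x1).
  by rewrite !numulA cz.
by rewrite numulA; apply: comm_span_comm.
Qed.

Lemma eval_word_comm a w1 w2 :
  comm_span A (eval_word a (w1 ++ w2) - eval_word a (w2 ++ w1)).
Proof.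
have [|/eqP w1N0] := eqVneq w1 [::] => [->|].
  by rewrite cats0 subrr; case: comm_span_subspace.
have [->|/eqP w2N0] := eqVneq w2 [::].
  by rewrite cats0 subrr; case: comm_span_subspace.
by rewrite !eval_word_cat //; apply: comm_span_comm.
Qed.

Lemma peval_comm a p q : comm_span A (peval a (p * q - q * p)).
Proof.
have -> : p * q - q * p = \sum_(k <- msupp p) \sum_(l <- msupp q)
   (<< p@_k * q@_l *g mmul k l >> - << p@_k * q@_l *g mmul l k >>).
  rewrite malgME [q * p]malgME [X in _ - X]exchange_big -sumrB.
  apply: eq_bigr => k _; rewrite -sumrB; apply: eq_bigr => l _.
  by rewrite [q@_l * _]mulrC.
rewrite peval_sum; apply: big_ind => [||k _]; [by case: comm_span_subspace.. |].
rewrite peval_sum; apply: big_ind => [||l _]; [by case: comm_span_subspace.. |].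
rewrite pevalB !pevalU -scalerBr !fmM.
by have [_ _ SZ] := comm_span_subspace; apply/SZ/eval_word_comm.
Qed.

Lemma cyc_equiv_to_identity_comm a f :
  cyc_equiv_to_identity A f -> comm_span A (peval a f).
Proof.
move=> [g [[_ gid] [n [p [q fg]]]]].
have g0 : peval a g = 0.
  have : values A g (peval a g) by exists a.
  by rewrite gid.
rewrite -[peval a f]subr0 -g0 -pevalB fg peval_sum.
apply: big_ind => [||i _]; [by case: comm_span_subspace.. |].
exact: peval_comm.
Qed.

Lemma cyclically_equivalent_refl f : cyclically_equivalent f f.
Proof.
by exists 0%N, (fun=> 0), (fun=> 0); rewrite big_ord0 subrr.
Qed.

End Evaluation.

(** * Directional derivatives and cyclic averages *)

Definition comm_sum (R : pzRingType) (h : R) := exists n (p q : 'I_n -> R),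
  h = \sum_i (p i * q i - q i * p i).

Lemma comm_sum_add (R : pzRingType) (h h' : R) :
  comm_sum h -> comm_sum h' -> comm_sum (h + h').
Proof.
move=> [n [p [q ->]]] [n' [p' [q' ->]]].
exists (n + n')%N, (ord_cat p p'), (ord_cat q q').
rewrite big_split_ord; congr (_ + _); apply: eq_bigr => i _.
  by rewrite !ord_catl.
by rewrite !ord_catr.
Qed.

Section Derivative.
Variables (F : fieldType) (charF0 : [pchar F] =i pred0) (A : nuAlgType F).
Implicit Types (a c : nat -> A) (f g : {free_alg F}) (u v x y z b : A).

Fixpoint word_deriv a c (w : seq nat) : A :=
  match w with
  | [::] => 0
  | [:: i] => c i
  | i :: w' => c i ** eval_word a w' + a i ** word_deriv a c w'
  end.

Lemma word_deriv_cons a c i w : w <> [::] ->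
  word_deriv a c (i :: w) = c i ** eval_word a w + a i ** word_deriv a c w.
Proof. by case: w. Qed.

Lemma eval_word_taylor a c w n : (size w < n)%N -> exists h : nat -> A,
  [/\ h 1%N = word_deriv a c w, forall k, (n <= k)%N -> h k = 0
    & forall t : F, eval_word (fun i => a i + t *: c i) w
                    = \sum_(k < n) t ^+ k *: h k].
Proof.
elim: w n => [|i w IHw] n /= lt_n.
  exists (fun k => if k == 0%N then empty_word_value A else 0).
  split=> // [k|t].
    by case: k lt_n => //; case: n.
  case: n lt_n => // n _; rewrite big_ord_recl expr0 scale1r big1 ?addr0 //.
  by move=> k _; rewrite scaler0.
case: n lt_n => // n; rewrite ltnS => lt_n.
have [w0|/eqP wN0] := eqVneq w [::].
  subst w.
  exists (fun k => if k == 0%N then a i else if k == 1%N then c i else 0).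
  split=> // [k|t]; first by case: k => [|[|k]] //; case: n lt_n.
  case: n lt_n => // n _.
  rewrite !big_ord_recl expr0 scale1r expr1 big1 ?addr0 //.
  by move=> k _; rewrite scaler0.
have [h [h1 h0 hE]] := IHw n lt_n.
exists (fun k => a i ** h k + (if k is k'.+1 then c i ** h k' else 0)); split.
- have h0E : h 0%N = eval_word a w.
    have := hE 0; rewrite (_ : (fun j => a j + 0 *: c j) = a); last first.
      by apply: funext => j; rewrite scale0r addr0.
    case: n lt_n {IHw h0 hE} => // n _.
    rewrite big_ord_recl expr0 scale1r => ->.
    by rewrite big1 ?addr0 // => k _; rewrite exprS mul0r scale0r.
  by case: w wN0 h1 h0E {IHw hE lt_n} => // j w _ -> ->; rewrite addrC.
- by case=> // k nk; rewrite !h0 ?numul0r ?addr0 // ltnW.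
move=> t; rewrite -[LHS]/(eval_word _ (i :: w)) eval_word_cons // hE.
rewrite numulDl numulZl !numul_sumr.
under [RHS]eq_bigr => k _ do rewrite scalerDr.
rewrite big_split /= [X in _ = X + _]big_ord_recr /= h0 // numul0r.
rewrite scaler0 addr0.
rewrite [X in _ = _ + X]big_ord_recl /= scaler0 add0r scaler_sumr.
congr (_ + _); apply: eq_bigr => k _; rewrite numulZr //.
by rewrite scalerA -exprS.
Qed.

Lemma eval_word_scale a (t : F) w : w <> [::] ->
  eval_word (fun i => t *: a i) w = t ^+ size w *: eval_word a w.
Proof.
elim: w => // i w IHw _.
have [->|/eqP wN0] := eqVneq w [::]; first by rewrite expr1.
by rewrite !eval_word_cons // IHw // numulZl numulZr scalerA exprS.
Qed.

(** The derivative is the coefficient of t in f (a + t c). *)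
Lemma deriv_subspace (S : set A) f a c : subspace S ->
  (forall a, S (peval a f)) -> S (\sum_(w <- msupp f) f@_w *: word_deriv a c w).
Proof.
move=> subS Sf.
pose n := (\max_(w <- msupp f) (size w)).+2.
have lt_n (w : {fmonom nat}) : w \in msupp f -> (size w < n)%N.
  move=> wf; rewrite ltnS leqW //; pose s (u : {fmonom nat}) := size u.
  exact: (@leq_bigmax_seq _ _ xpredT s w wf isT).
have [h hE] : exists h : {fmonom nat} -> nat -> A, forall w, w \in msupp f ->
  [/\ h w 1%N = word_deriv a c w, forall k, (n <= k)%N -> h w k = 0
    & forall t : F, eval_word (fun i => a i + t *: c i) w
                    = \sum_(k < n) t ^+ k *: h w k].
  have [|h hE] := @choice _ _ (fun (w : {fmonom nat}) hw => w \in msupp f ->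
    [/\ hw 1%N = word_deriv a c w, forall k, (n <= k)%N -> hw k = 0
      & forall t : F, eval_word (fun i => a i + t *: c i) w
                    = \sum_(k < n) t ^+ k *: hw k]); last by exists h.
  move=> w; have [wf|_] := boolP (w \in msupp f); last by exists (fun=> 0).
  by have [hw hwE] := eval_word_taylor a c (lt_n w wf); exists hw.
rewrite (eq_big_seq (fun w => f@_w *: h w 1%N)); last first.
  by move=> w /hE[->].
apply: (@poly_coef_subspace _ _ charF0 S n
  (fun k => \sum_(w <- msupp f) f@_w *: h w k)) => // t.
have := Sf (fun i => a i + t *: c i); congr S.
rewrite /peval; under [RHS]eq_bigr => k _ do rewrite scaler_sumr.
rewrite exchange_big; apply: eq_big_seq => w /hE[_ _ ->].
rewrite scaler_sumr; apply: eq_bigr => k _.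
by rewrite !scalerA mulrC.
Qed.

(** The chain rule for an inner derivation, which makes the span of the values
    of f a Lie ideal. *)
Lemma word_deriv_inner a b w :
  word_deriv a (fun i => a i ** b - b ** a i) w
  = eval_word a w ** b - b ** eval_word a w.
Proof.
elim: w => [|i w IHw].
  rewrite /= /empty_word_value; case: xgetP => [e _ ide|_].
    by have [-> ->] := ide b; rewrite subrr.
  by rewrite numul0l numul0r subrr.
have [->//|/eqP wN0] := eqVneq w [::].
rewrite word_deriv_cons // IHw eval_word_cons // numulBl numulBr !numulA.
by rewrite addrC addrA subrK.
Qed.

Lemma span_values_lie_ideal f x b : lin_span (values A f) x ->
  lin_span (values A f) (x ** b - b ** x).
Proof.
have subL := lin_span_subspace (values A f).
have [L0 LD LZ] := subL.
apply: (@lin_span_subset _ _ _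
  [set x | lin_span (values A f) (x ** b - b ** x)]).
  split=> [|x1 x2 L1 L2|k x1 L1] /=.
  - by rewrite numul0l numul0r subrr.
  - by rewrite numulDl numulDr opprD addrACA; apply: LD.
  - by rewrite numulZl numulZr -scalerBr; apply: LZ.
move=> _ [a ->] /=.
have -> : peval a f ** b - b ** peval a f
    = \sum_(w <- msupp f) f@_w *: word_deriv a (fun i => a i ** b - b ** a i) w.
  rewrite numul_suml numul_sumr -sumrB; apply: eq_bigr => w _.
  by rewrite word_deriv_inner scalerBr numulZl numulZr.
apply: deriv_subspace => // a'; apply: lin_span_gen.
by exists a'.
Qed.

(** Modulo commutators, the derivative of a word in the direction u a collects
    the rotations of the word; the prefix p is what the recursion on w moves
    out of the way. *)
Lemma word_deriv_rot_prefix a u p w :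
  comm_span A (word_act a p (word_deriv a (fun i => u ** a i) w)
    - \sum_(k < size w) u ** eval_word a (drop k w ++ p ++ take k w)).
Proof.
have [C0 CD _] := comm_span_subspace A.
elim: w p => [|i w IHw] p; first by rewrite big_ord0 word_act0 subrr.
have head_rot : comm_span A
    (word_act a p (u ** eval_word a (i :: w)) - u ** eval_word a (i :: w ++ p)).
  have [->|/eqP pN0] := eqVneq p [::]; first by rewrite cats0 subrr.
  rewrite -word_act_eval // -cat_cons eval_word_cat // (numulA u).
  exact: comm_span_comm.
rewrite -[size (i :: w)]/(size w).+1 big_ord_recl [X in eval_word a X]/= cats0.
have [w0|/eqP wN0] := eqVneq w [::].
  by subst w; rewrite big_ord0 addr0.
rewrite -[X in word_act a p X]/(word_deriv a (fun i => u ** a i) (i :: w)).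
rewrite word_deriv_cons // -numulA -eval_word_cons //.
have -> : word_act a p (u ** eval_word a (i :: w)
             + a i ** word_deriv a (fun i => u ** a i) w)
    = word_act a p (u ** eval_word a (i :: w))
      + word_act a (rcons p i) (word_deriv a (fun i => u ** a i) w).
  rewrite -cats1 word_act_cat /=.
  by elim: p {head_rot} => //= j p ->; rewrite numulDr.
rewrite opprD addrACA; apply: CD => //.
have := IHw (rcons p i); congr (comm_span A (_ - _)); apply: eq_bigr => k _.
by rewrite cat_rcons.
Qed.

Lemma word_deriv_rot a u w : comm_span A (word_deriv a (fun i => u ** a i) w
  - u ** \sum_(k < size w) eval_word a (rot k w)).
Proof.
by rewrite numul_sumr; have := word_deriv_rot_prefix a u [::] w.
Qed.

Definition cyclic_average f : {free_alg F} := \sum_(w <- msupp f)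
  \sum_(k < size w) << f@_w / (size w)%:R *g FMonom (rot k w) >>.

Lemma peval_cyclic_average a f : peval a (cyclic_average f)
  = \sum_(w <- msupp f) (f@_w / (size w)%:R) *:
      \sum_(k < size w) eval_word a (rot k w).
Proof.
rewrite peval_sum; apply: eq_bigr => w _; rewrite peval_sum scaler_sumr.
by apply: eq_bigr => k _; rewrite pevalU.
Qed.

(** The derivative of f in the direction u a is, modulo commutators, the product
    of u and the sum of all rotations of the words of f.  Replacing a by t a
    separates the words by their length, after which one can divide by it. *)
Lemma mul_cyclic_average (S : set A) f a u : subspace S ->
    (forall x, comm_span A x -> S x) -> (forall a, S (peval a f)) ->
  S (u ** peval a (cyclic_average f)).
Proof.
move=> subS CS Sf; have [S0 SD SZ] := subS.
pose n := (\max_(w <- msupp f) (size w)).+1.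
have lt_n (w : {fmonom nat}) : w \in msupp f -> (size w < n)%N.
  move=> wf; rewrite ltnS; pose s (u : {fmonom nat}) := size u.
  exact: (@leq_bigmax_seq _ _ xpredT s w wf isT).
pose R w := \sum_(k < size w) eval_word a (rot k w).
pose G l := \sum_(w <- msupp f | size w == l) f@_w *: R w.
have SG l : (l < n)%N -> S (u ** G l).
  apply: (@poly_coef_subspace _ _ charF0 S n (fun l => u ** G l)) => // t.
  have := deriv_subspace (fun i => t *: a i) (fun i => u ** (t *: a i)) subS Sf.
  pose D w := word_deriv (fun i => t *: a i) (fun i => u ** (t *: a i)) w.
  have SD' : S (\sum_(w <- msupp f) f@_w *: (D w -
      u ** \sum_(k < size w) eval_word (fun i => t *: a i) (rot k w))).
    by apply: subspace_sum => // w _; apply/CS/word_deriv_rot.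
  move=> /(subspaceB subS)/(_ SD'); congr S; rewrite -sumrB.
  under eq_bigr => w _ do rewrite -scalerBr subKr.
  under [RHS]eq_bigr => j _ do rewrite numul_sumr scaler_sumr.
  rewrite (exchange_big_dep xpredT) //=; apply: eq_big_seq => w wf.
  rewrite (big_pred1 (Ordinal (lt_n w wf))) => [|j]; last first.
    by rewrite /= -val_eqE /= eq_sym.
  rewrite /= numulZr scalerA mulrC -scalerA; congr (_ *: _).
  rewrite -numulZr /R scaler_sumr; congr (_ ** _); apply: eq_bigr => k _.
  rewrite eval_word_scale ?size_rot // => /(congr1 size); rewrite size_rot.
  by move: k => [k]; case: (size w).
rewrite peval_cyclic_average.
have -> : u ** (\sum_(w <- msupp f) (f@_w / (size w)%:R) *: R w)
    = \sum_(l < n) l%:R^-1 *: (u ** G l).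
  under [RHS]eq_bigr => l _ do rewrite numul_sumr scaler_sumr.
  rewrite (exchange_big_dep xpredT) //= numul_sumr; apply: eq_big_seq => w wf.
  rewrite (big_pred1 (Ordinal (lt_n w wf))) => [|l]; last first.
    by rewrite /= -val_eqE /= eq_sym.
  by rewrite /= !numulZr scalerA mulrC.
by apply: subspace_sum => // l _; apply: SG.
Qed.

Lemma cyclic_average_equiv f : f@_(mone : {fmonom nat}) = 0 ->
  cyclically_equivalent f (cyclic_average f).
Proof.
move=> f1; suff: comm_sum (f - cyclic_average f) by [].
have sum0 : comm_sum 0 by exists 0%N, (fun=> 0), (fun=> 0); rewrite big_ord0.
rewrite {1}[f]monalgE -sumrB big_seq.
apply: big_ind => // [|w wf]; first exact: comm_sum_add.
have size_w : (size w)%:R != 0 :> F.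
  rewrite ((pcharf0P F).1 charF0) size_eq0; apply: contraTneq wf => w0.
  have -> : w = mone by apply/eqP; rewrite fmP w0 fm1.
  by rewrite -mcoeff_neq0 f1 eqxx.
have -> : << f@_w *g w >> = \sum_(k < size w) << f@_w / (size w)%:R *g w >>
    :> {free_alg F}.
  rewrite sumr_const card_ord -monalgUMn; congr (mkmalgU _ _).
  by rewrite -[RHS]mulr_natr divfK.
rewrite -sumrB; apply: big_ind => // [|k _]; first exact: comm_sum_add.
exists 1%N, (fun=> << f@_w / (size w)%:R *g FMonom (take k w) >>),
  (fun=> << FMonom (drop k w) >>).
rewrite big_ord1.
rewrite [X in _ = X - _]malgM_def [X in _ = _ - X]malgM_def.
rewrite !fgmulUU mulr1 mul1r.
have -> : mmul (FMonom (take k w)) (FMonom (drop k w)) = w.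
  by apply/eqP; rewrite fmP fmM /= cat_take_drop.
have -> // : mmul (FMonom (drop k w)) (FMonom (take k w)) = FMonom (rot k w).
by apply/eqP; rewrite fmP fmM.
Qed.

Lemma cyclic_average_coef1 f : (cyclic_average f)@_(mone : {fmonom nat}) = 0.
Proof.
rewrite raddf_sum big1 //= => w _; rewrite raddf_sum big1 //= => k _.
rewrite mcoeffU fmP fm1 /= -size_eq0 size_rot.
by move: k => [k]; case: (size w).
Qed.

End Derivative.

(** * The central closure *)

Section CentralClosure.
Variables (F : fieldType) (charF0 : [pchar F] =i pred0).
Variables (A : nuAlgType F) (primeA : prime_algebra A) (PIA : PI A).
Variables (a0 : A) (a0N0 : a0 <> 0).
Variables (B : unitAlgType F) (iota : A -> B).
Hypothesis closureB : is_central_closure iota.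
Implicit Types (x y z : A) (b k : B).

Local Notation K := (center_fractions iota).

Let iota_inj : injective iota. Proof. by case: closureB => [[]]. Qed.
Let iota_lin (c : F) a x : iota (c *: a + x) = c *: iota a + iota x.
Proof. by case: closureB => [[]]. Qed.
Let iotaM a x : iota (a ** x) = iota a * iota x.
Proof. by case: closureB => [[]]. Qed.
Let iota_unit z : center A z -> z <> 0 -> iota z \is a GRing.unit.
Proof. by case: closureB => _ + _; apply. Qed.
Let fraction b : exists z a, [/\ center A z, z <> 0 & b = (iota z)^-1 * iota a].
Proof. by case: closureB => _ _; apply. Qed.

Let iotaD a x : iota (a + x) = iota a + iota x.
Proof. by rewrite -[a]scale1r iota_lin !scale1r. Qed.
Let iota0 : iota 0 = 0.
Proof. by apply: (addrI (iota 0)); rewrite -iotaD !addr0. Qed.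
Let iotaZ (c : F) a : iota (c *: a) = c *: iota a.
Proof. by rewrite -[c *: a]addr0 iota_lin iota0 addr0. Qed.
Let iotaB a x : iota (a - x) = iota a - iota x.
Proof. by rewrite iotaD -scaleN1r iotaZ scaleN1r. Qed.
Let iota_sum I (r : seq I) (P : pred I) (h : I -> A) :
  iota (\sum_(i <- r | P i) h i) = \sum_(i <- r | P i) iota (h i).
Proof. by apply: (big_morph iota); [apply: iotaD | apply: iota0]. Qed.

Lemma center_mul z x : center A z -> center A x -> center A (z ** x).
Proof. by move=> cz cx a; rewrite -numulA cx numulA cz numulA. Qed.

Lemma center_mul_neq0 z x : center A z -> z <> 0 -> x <> 0 -> z ** x <> 0.
Proof.
move=> cz zN0 xN0 zx0; apply: (zN0); have zrx r : z ** r ** x = 0.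
  by rewrite cz -numulA zx0 numul0r.
by case: (prime_elt primeA zrx).
Qed.

Lemma iota_center_comm z b : center A z -> iota z * b = b * iota z.
Proof.
move=> cz; have [z' [a [cz' z'N0 ->]]] := fraction b.
rewrite -[in RHS]mulrA -iotaM -cz iotaM !mulrA; congr (_ * _).
apply: (mulIr (iota_unit cz' z'N0)); apply: (mulrI (iota_unit cz' z'N0)).
by rewrite -!mulrA mulVr ?iota_unit // mulr1 mulVKr ?iota_unit // -!iotaM cz.
Qed.

Lemma fractions_center k b : K k -> k * b = b * k.
Proof.
move=> [z [w [cz zN0 cw ->]]].
rewrite -mulrA iota_center_comm // mulrA [RHS]mulrA; congr (_ * _).
apply: (mulIr (iota_unit cz zN0)).
rewrite -[RHS]mulrA mulVr ?iota_unit // mulr1 -mulrA -iota_center_comm //.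
by rewrite mulKr ?iota_unit.
Qed.

Lemma fractionsM k k' : K k -> K k' -> K (k * k').
Proof.
move=> Kk Kk'; have [z [w [cz zN0 cw kE]]] := Kk.
have [z' [w' [cz' z'N0 cw' k'E]]] := Kk'.
exists (z' ** z), (w ** w'); split; [exact: center_mul | exact: center_mul_neq0
  | exact: center_mul |].
rewrite !iotaM invrM ?iota_unit // {1}kE -!mulrA; congr (_ * _).
by rewrite [LHS]iota_center_comm // k'E -mulrA [iota w' * _]iota_center_comm.
Qed.

Lemma fractionsD k k' : K k -> K k' -> K (k + k').
Proof.
move=> [z [w [cz zN0 cw ->]]] [z' [w' [cz' z'N0 cw' ->]]].
have czz' := center_mul cz cz'; have zz'N0 := center_mul_neq0 cz zN0 z'N0.
exists (z ** z'), (z' ** w + z ** w'); split=> // [a|].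
  by rewrite numulDl numulDr; congr (_ + _); apply: center_mul.
apply: (mulrI (iota_unit czz' zz'N0)); rewrite mulVKr ?iota_unit //.
rewrite mulrDr iotaD.
by rewrite {1}cz !iotaM -!mulrA !mulVKr ?iota_unit.
Qed.

Lemma iota_fraction z : center A z -> K (iota z).
Proof.
move=> cz; have [z1 [a [cz1 z1N0 _]]] := fraction 0.
exists z1, (z1 ** z); split=> //; first exact: center_mul.
by rewrite iotaM mulKr ?iota_unit.
Qed.

Lemma fraction_unit k : K k -> k <> 0 -> k \is a GRing.unit /\ K k^-1.
Proof.
move=> [z [w [cz zN0 cw kE]]] kN0.
have wN0 : w <> 0 by move=> w0; apply: kN0; rewrite kE w0 iota0 mulr0.
split; first by rewrite kE unitrMl ?unitrV ?iota_unit.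
exists w, z; split=> //.
by rewrite kE invrM ?unitrV ?iota_unit // invrK.
Qed.

Lemma fraction_inv z : center A z -> z <> 0 -> K (iota z)^-1.
Proof.
move=> cz zN0; have [|_ //] := fraction_unit (iota_fraction cz).
by rewrite -iota0 => /iota_inj.
Qed.

Lemma fraction1 : K 1.
Proof.
have [z [a [cz zN0 _]]] := fraction 0.
by exists z, z; split=> //; rewrite mulVr ?iota_unit.
Qed.

Lemma fraction_scalar (c : F) : K (c *: 1).
Proof.
have [z [a [cz zN0 _]]] := fraction 0.
exists z, (c *: z); split=> //.
  by move=> x; rewrite numulZl numulZr cz.
by rewrite iotaZ -scalerAr mulVr ?iota_unit.
Qed.

Lemma iota_fractionP x : K (iota x) -> center A x.
Proof. by move=> Kx a; apply: iota_inj; rewrite !iotaM fractions_center. Qed.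

Let z0P : exists2 z0, center A z0 & z0 <> 0.
Proof. by have [z [a [cz zN0 _]]] := fraction 0; exists z. Qed.

(** * Commutators in the central closure *)

Lemma commutator_subspace : subspace (commutator_span B).
Proof. exact: lin_span_subspace. Qed.

Lemma commutator_mul k b :
  K k -> commutator_span B b -> commutator_span B (k * b).
Proof.
move=> Kk [n [c [v [vc ->]]]]; rewrite mulr_sumr.
under eq_bigr => i _ do rewrite -scalerAr.
apply: subspace_sum => [|i _]; first exact: commutator_subspace.
have [b1 [b2 ->]] := vc i; apply: lin_span_gen; exists (k * b1), b2.
by rewrite mulrBr !mulrA (fractions_center b2 Kk).
Qed.

Lemma iota_comm_span x : comm_span A x -> commutator_span B (iota x).
Proof.
move=> [n [c [v [vc ->]]]]; rewrite iota_sum.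
under eq_bigr => i _ do rewrite iotaZ.
apply: subspace_sum => [|i _]; first exact: commutator_subspace.
have [x1 [x2 ->]] := vc i; apply: lin_span_gen; exists (iota x1), (iota x2).
by rewrite iotaB !iotaM.
Qed.

(** A common denominator brings a sum of commutators of B down to A. *)
Lemma commutator_spanP b : commutator_span B b ->
  exists z x, [/\ center A z, z <> 0, comm_span A x & iota z * b = iota x].
Proof.
have [C0 CD CZ] := comm_span_subspace A.
move=> Cb; pose S : set B := [set b | exists z x,
  [/\ center A z, z <> 0, comm_span A x & iota z * b = iota x]].
suff : S b by [].
apply: lin_span_subset Cb => [|_ [b1 [b2 ->]]].
  split=> [|b1 b2|c b1].
  - have [z cz zN0] := z0P; exists z, 0; split=> //.
    by rewrite mulr0 iota0.
  - move=> [z [x [cz zN0 Cx zb]]] [z' [x' [cz' z'N0 Cx' zb']]].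
    exists (z ** z'), (z' ** x + z ** x'); split.
    + exact: center_mul.
    + exact: center_mul_neq0.
    + by apply: CD; apply: comm_span_center.
    + by rewrite mulrDr iotaD {1}cz !iotaM -!mulrA zb zb'.
  - move=> [z [x [cz zN0 Cx zb]]]; exists z, (c *: x); split=> //.
      exact: CZ.
    by rewrite -scalerAr zb iotaZ.
have [z [a [cz zN0 ->]]] := fraction b1.
have [z' [a' [cz' z'N0 ->]]] := fraction b2.
exists (z ** z'), (a ** a' - a' ** a); split.
- exact: center_mul.
- exact: center_mul_neq0.
- exact: comm_span_comm.
have Kz := fraction_inv cz zN0; have Kz' := fraction_inv cz' z'N0.
have -> : (iota z)^-1 * iota a * ((iota z')^-1 * iota a')
    - (iota z')^-1 * iota a' * ((iota z)^-1 * iota a)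
    = (iota z')^-1 * ((iota z)^-1 * (iota a * iota a' - iota a' * iota a)).
  rewrite !mulrBr; congr (_ - _).
    by rewrite [LHS]mulrA -(fractions_center _ Kz') !mulrA.
  by rewrite -[LHS]mulrA (mulrA (iota a')) -(fractions_center _ Kz) !mulrA.
rewrite iotaM -mulrA mulVKr ?iota_unit // mulVKr ?iota_unit //.
by rewrite iotaB !iotaM.
Qed.

Lemma fraction_commutator0 k : K k -> commutator_span B k -> k = 0.
Proof.
move=> Kk /commutator_spanP[z [x [cz zN0 Cx zk]]].
have cx : center A x.
  apply: iota_fractionP; rewrite -zk.
  by apply: fractionsM => //; apply: iota_fraction.
have x0 := center_comm_span0 charF0 primeA PIA a0N0 cx Cx.
by rewrite -[k](mulKr (iota_unit cz zN0)) zk x0 iota0 mulr0.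
Qed.

Lemma fraction_plus_commutator b :
  exists2 k, K k & commutator_span B (b - k).
Proof.
have [z0 cz0 z0N0] := z0P.
have [e [ce eN0 eP]] := center_plus_comm_span charF0 primeA PIA a0N0 cz0 z0N0.
have [z [y [cz zN0 bE]]] := fraction b.
have [w cw Cw] := eP y.
have Kze := fraction_inv (center_mul cz ce) (center_mul_neq0 cz zN0 eN0).
exists ((iota (z ** e))^-1 * iota w).
  by apply: fractionsM => //; apply: iota_fraction.
have -> : b = (iota (z ** e))^-1 * iota (y ** e).
  rewrite bE -(ce y) -(ce z) !iotaM invrM ?iota_unit // -mulrA.
  by rewrite mulKr ?iota_unit.
by rewrite -mulrBr -iotaB; apply: commutator_mul => //; apply: iota_comm_span.
Qed.

(** * Simplicity and Lie ideals *)

Lemma closure_simple (I : set B) b : I 0 ->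
    (forall b1 b2, I b1 -> I b2 -> I (b1 + b2)) ->
    (forall c b, I b -> I (c * b) /\ I (b * c)) -> I b -> b <> 0 ->
  I 1.
Proof.
move=> I0 ID IM Ib bN0; have [z [a [cz zN0 bE]]] := fraction b.
have Ia : I (iota a).
  rewrite -[iota a](mulVKr (iota_unit cz zN0)) -bE.
  by have [] := IM (iota z) b Ib.
have aN0 : a <> 0 by move=> a_0; apply: bN0; rewrite bE a_0 iota0 mulr0.
have idJ : is_ideal [set x | I (iota x)].
  split=> [|x y Ix Iy|c x Ix|y x Ix] /=.
  - by rewrite iota0.
  - by rewrite iotaD; apply: ID.
  - by rewrite iotaZ -[iota x]mul1r scalerAl; case: (IM (c *: 1) _ Ix).
  - by rewrite !iotaM; apply: IM.
have [z0 cz0 z0N0] := z0P.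
have [w [Iw cw wN0]] :=
  ideal_meets_center charF0 primeA PIA a0N0 cz0 z0N0 idJ Ia aN0.
rewrite -(mulVr (iota_unit cw wN0)).
by have [] := IM (iota w)^-1 _ Iw.
Qed.

Lemma closure_prime b : (forall c, b * c * b = 0) -> b = 0.
Proof.
move=> bb; apply: contrapT => bN0.
suff : [set w | forall c, b * c * w = 0] 1.
  by move=> /(_ 1); rewrite !mulr1.
apply: (@closure_simple _ b) => //.
- by move=> c; rewrite mulr0.
- by move=> b1 b2 H1 H2 c; rewrite mulrDr H1 H2 addr0.
- by move=> c w H; split=> c'; rewrite mulrA;
    [rewrite -(mulrA b) H | rewrite H mul0r].
Qed.

(** Herstein's theorem on the Lie ideals T of a simple ring.  The elements u
    with [u, B] in T form a subring and Lie ideal U that contains T.  If U is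
    not commutative it contains the ideal generated by a commutator, hence
    everything; if it is commutative then [a, [a, B]] = 0 for a in T, which
    forces a to be central. *)
Lemma lie_ideal_dichotomy (T : set B) : T 0 ->
    (forall b1 b2, T b1 -> T b2 -> T (b1 + b2)) -> (forall b, T b -> T (- b)) ->
    (forall t b, T t -> T (t * b - b * t)) ->
  (forall t, T t -> K t) \/ (forall b1 b2, T (b1 * b2 - b2 * b1)).
Proof.
move=> T0 TD TN TL.
pose U : set B := [set u | forall b, T (u * b - b * u)].
have TU t : T t -> U t by move=> Tt b; apply: TL.
have UD u v : U u -> U v -> U (u + v).
  by move=> Uu Uv b; rewrite mulrDl mulrDr opprD addrACA; apply: TD.
have UM u v : U u -> U v -> U (u * v).
  move=> Uu Uv b.
  rewrite (_ : _ - _ = (u * (v * b) - v * b * u) + (v * (b * u) - b * u * v)).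
    exact: TD.
  by rewrite !mulrA addrA subrK.
have UN u : U u -> U (- u).
  by move=> Uu b; rewrite mulNr mulrN -opprD; apply/TN/Uu.
have UL u b : U u -> U (u * b - b * u) by move=> Uu; apply/TU/Uu.
have [Ucomm|] := pselect (forall u v, U u -> U v -> u * v = v * u).
  left=> t Tt; suff ct b : t * b = b * t.
    have [z [x [cz zN0 tE]]] := fraction t.
    exists z, x; split=> // y; apply: iota_inj; rewrite !iotaM.
    have -> : iota x = iota z * t by rewrite tE mulVKr ?iota_unit.
    by rewrite -mulrA ct mulrA iota_center_comm // -mulrA.
  have Ut := TU t Tt.
  pose D b := t * b - b * t.
  have DM b1 b2 : D (b1 * b2) = D b1 * b2 + b1 * D b2.
    by rewrite /D mulrBl mulrBr !mulrA addrA subrK.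
  have DD0 b1 : D (D b1) = 0.
    by apply/eqP; rewrite subr_eq0; apply/eqP/Ucomm => //; apply: UL.
  have DD b1 b2 : D (b1 + b2) = D b1 + D b2.
    by rewrite /D mulrDl mulrDr opprD addrACA.
  have Dprod b1 b2 : D b1 * D b2 = 0.
    have := DD0 (b1 * b2).
    rewrite DM DD !DM !DD0 mul0r mulr0 add0r addr0 -mulr2n -scaler_nat => /eqP.
    by rewrite scaler_eq0 ((pcharf0P F).1 charF0) => /eqP.
  suff : D b = 0 by move/eqP; rewrite subr_eq0 => /eqP.
  apply: closure_prime => c.
  have := Dprod b (c * b).
  by rewrite DM mulrDr !mulrA Dprod mul0r add0r.
move=> /existsNP[u] /existsNP[v] /not_implyP[Uu] /not_implyP[Uv] uv; right.
suff U1 : forall b1, U b1 by move=> b1 b2; apply: U1.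
pose I : set B := [set w | forall b1 b2, U (b1 * w * b2)].
have IU b1 : I 1 -> U b1 by move=> /(_ b1 1); rewrite !mulr1.
move=> b1; apply: IU.
apply: (@closure_simple I (u * v - v * u)).
- by move=> c c'; rewrite mulr0 mul0r; apply: TU.
- by move=> w w' Iw Iw' c c'; rewrite mulrDr mulrDl; apply: UD.
- move=> c w Iw; split=> c1 c2; first by rewrite mulrA; apply: Iw.
  by rewrite !mulrA -(mulrA _ c c2); apply: Iw.
- have Ur c : U ((u * v - v * u) * c).
    rewrite (_ : _ * c = (u * (v * c) - v * c * u) - v * (u * c - c * u)).
      by apply: UD; [apply: UL | apply/UN/UM => //; apply: UL].
    by rewrite mulrBl mulrBr opprB !mulrA addrA subrK.
  move=> c c'; rewrite -mulrA; set w := _ * c'.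
  rewrite (_ : c * w = - (w * c - c * w) + w * c); last by rewrite opprB subrK.
  apply: UD; first by apply/UN/UL/Ur.
  by rewrite /w -mulrA; apply: Ur.
by move/eqP; rewrite subr_eq0 => /eqP.
Qed.

(** * Spans over the field of fractions of the center *)

Section Tilde.
Variable L : set A.

Lemma tilde_gen x : L x -> tilde iota L (iota x).
Proof.
move=> Lx; exists 1%N, (fun=> 1), (fun=> x); split=> [_|].
  by split=> //; apply: fraction1.
by rewrite big_ord1 mul1r.
Qed.

Lemma tilde0 : tilde iota L 0.
Proof.
by exists 0%N, (fun=> 0), (fun=> 0); rewrite big_ord0; split=> // [[]].
Qed.

Lemma tildeD b b' : tilde iota L b -> tilde iota L b' -> tilde iota L (b + b').
Proof.
move=> [n [k [v [kv ->]]]] [n' [k' [v' [kv' ->]]]].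
exists (n + n')%N, (ord_cat k k'), (ord_cat v v'); split.
  by move=> i; rewrite /ord_cat; case: split.
rewrite big_split_ord; congr (_ + _); apply: eq_bigr => i _.
  by rewrite !ord_catl.
by rewrite !ord_catr.
Qed.

Lemma tildeM k b : K k -> tilde iota L b -> tilde iota L (k * b).
Proof.
move=> Kk [n [k' [v [kv ->]]]]; exists n, (fun i => k * k' i), v; split.
  by move=> i; have [Kk' Lv] := kv i; split=> //; apply: fractionsM.
by rewrite mulr_sumr; apply: eq_bigr => i _; rewrite mulrA.
Qed.

Lemma tilde_subset (T : set B) : T 0 ->
    (forall b b', T b -> T b' -> T (b + b')) ->
    (forall k b, K k -> T b -> T (k * b)) ->
    (forall x, L x -> T (iota x)) ->
  forall b, tilde iota L b -> T b.
Proof.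
move=> T0 TD TM TL _ [n [k [v [kv ->]]]].
by apply: big_ind => // i _; have [Kk Lv] := kv i; apply/TM/TL.
Qed.

Lemma tilde_subspace : subspace (tilde iota L).
Proof.
split=> [|b b'|c b Tb]; [exact: tilde0 | exact: tildeD |].
rewrite -[b]mul1r scalerAl; apply: tildeM => //.
exact: fraction_scalar.
Qed.

Lemma tilde_lie_ideal t b :
    (forall x y, L x -> L (x ** y - y ** x)) ->
  tilde iota L t -> tilde iota L (t * b - b * t).
Proof.
move=> LL Tt.
apply: (tilde_subset (T := [set t | tilde iota L (t * b - b * t)])) Tt => /=.
- by rewrite mul0r mulr0 subrr; apply: tilde0.
- by move=> b1 b2 T1 T2; rewrite mulrDl mulrDr opprD addrACA; apply: tildeD.
- move=> k b1 Kk T1; rewrite mulrA -[b * k]fractions_center // -!mulrA -mulrBr.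
  exact: tildeM.
move=> x Lx; have [z [a [cz zN0 ->]]] := fraction b.
have Kz := fraction_inv cz zN0.
rewrite mulrA -(fractions_center (iota x) Kz) -!mulrA -mulrBr -!iotaM -iotaB.
by apply/tildeM => //; apply/tilde_gen/LL.
Qed.

End Tilde.

(** * The span of the values of a polynomial *)

Variables (f : {free_alg F}) (evalf : evaluable A f).

Let L := lin_span (values A f).
Let T := tilde iota L.

Let value_tilde a : T (iota (peval a f)).
Proof. by apply/tilde_gen/lin_span_gen; exists a. Qed.

Lemma tilde_values_subset (X : set B) : X 0 ->
    (forall b b', X b -> X b' -> X (b + b')) ->
    (forall k b, K k -> X b -> X (k * b)) ->
  (forall a, X (iota (peval a f))) -> forall b, T b -> X b.
Proof.
move=> X0 XD XM Xf; apply: tilde_subset => // x.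
apply: (@lin_span_subset _ _ _ [set x | X (iota x)]) => [|_ [a ->]] //=.
split=> [|x1 x2 X1 X2|c x1 X1] /=; first by rewrite iota0.
  by rewrite iotaD; apply: XD.
rewrite iotaZ -[iota x1]mul1r scalerAl.
by apply: XM => //; apply: fraction_scalar.
Qed.

Lemma values_neq0 : ~ polynomial_identity A f -> exists a, peval a f <> 0 :> A.
Proof.
move=> nid; apply: contrapT => /forallNP f0; apply: nid; split=> //.
have val0 a : peval a f = 0 :> A by apply: contrapT; apply: f0.
by apply/seteqP; split=> [_ [a ->]|_ ->]; rewrite ?val0 //; exists (fun=> 0).
Qed.

Lemma tilde_identity : polynomial_identity A f -> T = [set 0].
Proof.
move=> [_ fid]; apply/seteqP; split=> [|_ ->]; last exact: tilde0.
apply: tilde_values_subset => //= [_ _ -> ->|k _ _ ->|a].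
- by rewrite addr0.
- by rewrite mulr0.
have : values A f (peval a f) by exists a.
by rewrite fid => ->.
Qed.

Lemma tilde_central : central_polynomial A f -> T = K.
Proof.
move=> [_ nid cf]; apply/seteqP; split.
  apply: tilde_values_subset.
  - by rewrite -iota0; apply: iota_fraction => a; rewrite numul0l numul0r.
  - exact: fractionsD.
  - by move=> k b; apply: fractionsM.
  - by move=> a; apply/iota_fraction/cf; exists a.
have [a faN0] := values_neq0 nid.
have cfa : center A (peval a f) by apply: cf; exists a.
move=> k Kk.
rewrite -[k](mulrVK (iota_unit cfa faN0)).
apply: tildeM; last exact: value_tilde.
by apply: fractionsM => //; apply: fraction_inv.
Qed.

(** Herstein's dichotomy for T, which is a Lie ideal of the simple ring B. *)
Lemma tilde_dichotomy :
  (forall a, center A (peval a f)) \/ (forall b, commutator_span B b -> T b).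
Proof.
have [T0 TD TZ] := tilde_subspace L.
have TN b : T b -> T (- b) by move=> Tb; rewrite -scaleN1r; apply: TZ.
have TL t b : T t -> T (t * b - b * t).
  by apply: tilde_lie_ideal => x y; apply: span_values_lie_ideal.
have [TK|Tcomm] := lie_ideal_dichotomy T0 TD TN TL.
  by left=> a; apply/iota_fractionP/TK/value_tilde.
right; apply: lin_span_subset => [|_ [b1 [b2 ->]]]; last exact: Tcomm.
exact: tilde_subspace.
Qed.

Lemma tilde_comm : ~ polynomial_identity A f -> cyc_equiv_to_identity A f ->
  T = commutator_span B.
Proof.
move=> nid cyc; have [C0 CD _] := commutator_subspace.
have Cf a : commutator_span B (iota (peval a f)).
  exact/iota_comm_span/cyc_equiv_to_identity_comm.
apply/seteqP; split.
  by apply: tilde_values_subset => // k b; apply: commutator_mul.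
have [cf|//] := tilde_dichotomy.
have [a faN0] := values_neq0 nid; case: faN0.
by apply: iota_inj; rewrite iota0; apply: fraction_commutator0 => //;
  apply: iota_fraction.
Qed.

(** If all values of f are sums of commutators, then so are all products
    u h (a), where h is the cyclic average of f.  The elements x with A x in the
    span of the commutators form an ideal, which is 0 because it contains no
    nonzero central element. *)
Lemma commutator_values_cyc :
    (forall a, commutator_span B (iota (peval a f))) ->
  cyc_equiv_to_identity A f.
Proof.
move=> Cf; pose S : set A := [set x | commutator_span B (iota x)].
have subS : subspace S.
  have [C0 CD CZ] := commutator_subspace.
  split=> [|x y Sx Sy|c x Sx]; rewrite /S /=.
  - by rewrite iota0.
  - by rewrite iotaD; apply: CD.
  - by rewrite iotaZ; apply: CZ.
have [S0 SD SZ] := subS.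
have CS x : comm_span A x -> S x by apply: iota_comm_span.
have cS0 z : center A z -> S z -> z = 0.
  move=> cz Sz; apply: iota_inj; rewrite iota0.
  by apply: fraction_commutator0 => //; apply: iota_fraction.
pose I : set A := [set x | forall u, S (u ** x)].
have idI : is_ideal I.
  split=> [u|x y Ix Iy u|c x Ix u|y x Ix].
  - by rewrite numul0r.
  - by rewrite numulDr; apply: SD.
  - by rewrite numulZr; apply: SZ.
  split=> u; first by rewrite numulA; apply: Ix.
  have -> : u ** (x ** y) = (u ** x ** y - y ** (u ** x)) + y ** u ** x.
    by rewrite !numulA subrK.
  by apply: SD; [apply/CS/comm_span_comm | apply: Ix].
have I0 x : I x -> x = 0.
  move=> Ix; apply: contrapT => xN0; have [z0 cz0 z0N0] := z0P.
  have [z [Iz cz zN0]] :=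
    ideal_meets_center charF0 primeA PIA a0N0 cz0 z0N0 idI Ix xN0.
  by apply: (center_mul_neq0 cz zN0 zN0); apply: cS0 (Iz z); apply: center_mul.
(* The constant term is the value of f at 0. *)
have f1 : f@_(mone : {fmonom nat}) = 0.
  have [[e ide]|//] := evalf.
  have f1E : peval (fun=> 0) f = f@_(mone : {fmonom nat}) *: e.
    rewrite (@pevalEw _ _ _ _ (msupp f `|` [fset mone])%fset) ?fsubsetUl //.
    rewrite (bigD1_seq mone) ?fset_uniq ?inE ?eqxx ?orbT //= big1 ?addr0.
      rewrite fm1 /= /empty_word_value; case: xgetP => [e' _ ide'|/(_ e)//].
      by rewrite -[e']((ide e').1) (ide' e).2.
    move=> w; rewrite fmP fm1; case: (w : seq nat) => // i [|j s] _ /=.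
      by rewrite scaler0.
    by rewrite numul0l scaler0.
  have : peval (fun=> 0) f = 0 :> A.
    apply: cS0; last exact: Cf.
    by rewrite f1E => x; rewrite numulZl numulZr (ide x).1 (ide x).2.
  rewrite f1E => /eqP; rewrite scaler_eq0 => /orP[/eqP //|/eqP e0].
  by case: a0N0; rewrite -(ide a0).1 e0 numul0l.
exists (cyclic_average f); split; last exact: cyclic_average_equiv.
split; first by right; apply: cyclic_average_coef1.
have h0 a : peval a (cyclic_average f) = 0 :> A.
  by apply: I0 => u; apply: mul_cyclic_average.
by apply/seteqP; split=> [_ [a ->]|_ ->]; rewrite ?h0 //; exists (fun=> 0).
Qed.

(** T contains [B, B], of codimension 1 over K, and an element outside. *)
Lemma tilde_full : ~ central_polynomial A f -> ~ cyc_equiv_to_identity A f ->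
  T = [set: B].
Proof.
move=> ncen ncyc; have nid : ~ polynomial_identity A f.
  move=> fid; apply: ncyc; exists f; split=> //.
  exact: cyclically_equivalent_refl.
have [cf|CT] := tilde_dichotomy.
  by case: ncen; split=> // _ [a ->].
have [a nCa] : exists a, ~ commutator_span B (iota (peval a f)).
  by apply/existsNP => Cf; apply: ncyc; apply: commutator_values_cyc.
have [k Kk Ck] := fraction_plus_commutator (iota (peval a f)).
have kN0 : k <> 0 by move=> k0; apply: nCa; rewrite -[iota _]subr0 -k0.
have Tk : T k.
  rewrite -[k](subKr (iota (peval a f))).
  by apply: subspaceB (CT _ Ck); [apply: tilde_subspace | apply: value_tilde].
have [k_unit Kkinv] := fraction_unit Kk kN0.
apply/seteqP; split=> // b _; have [k' Kk' Ck'] := fraction_plus_commutator b.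
rewrite -[b](subrK k'); apply: tildeD; first exact: CT.
rewrite -[k'](mulrVK k_unit); apply: tildeM => //.
exact: fractionsM.
Qed.

End CentralClosure.

Theorem theorem4p5 (F : fieldType) (charF0 : [pchar F] =i pred0)
    (A : nuAlgType F) (noncommA : noncommutative A)
    (primeA : prime_algebra A) (PIA : PI A)
    (f : {free_alg F}) (evalf : evaluable A f) :
  let L := lin_span (values A f) in
  let case1 := polynomial_identity A f in
  let case2 := central_polynomial A f in
  let case3 := ~ polynomial_identity A f /\ cyc_equiv_to_identity A f in
  let case4 := ~ central_polynomial A f /\ ~ cyc_equiv_to_identity A f in
  exactly_one4 case1 case2 case3 case4 /\
  forall (B : unitAlgType F) (iota : A -> B), is_central_closure iota ->
    [/\ case1 -> tilde iota L = [set 0],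
        case2 -> tilde iota L = center_fractions iota,
        case3 -> tilde iota L = commutator_span B
      & case4 -> tilde iota L = [set: B]].
Proof.
move=> L case1 case2 case3 case4.
have [a0 a0N0] : exists a : A, a <> 0.
  have [a [b ab]] := noncommA; exists a => a0; apply: ab.
  by rewrite a0 numul0l numul0r.
split; last first.
  move=> B iota closureB; split.
  - exact: tilde_identity.
  - exact: tilde_central.
  - by case; apply: (tilde_comm charF0 primeA PIA a0N0 closureB).
  - by case; apply: (tilde_full charF0 primeA PIA a0N0 closureB).
have cyc1 : case1 -> cyc_equiv_to_identity A f.
  by move=> fid; exists f; split=> //; apply: cyclically_equivalent_refl.
have cen_ncyc : case2 -> ~ cyc_equiv_to_identity A f.
  move=> [_ nid cf] cyc; have [a faN0] := values_neq0 evalf nid.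
  apply: faN0; apply: (center_comm_span0 charF0 primeA PIA a0N0).
    by apply: cf; exists a.
  exact: cyc_equiv_to_identity_comm.
have [c1|n1] := pselect case1; last have [c2|n2] := pselect case2;
  last have [cyc|ncyc] := pselect (cyc_equiv_to_identity A f).
- by constructor 1; split=> // [[]|[]|[_]] //; apply; exact: cyc1.
- by constructor 2; split=> // [[_]|[]] //; apply: cen_ncyc.
- by constructor 3; split=> // [[_]].
- by constructor 4; split=> // [[_]].
Qed.
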